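(* Let $h\colon L^{n-s}\to\mathbb{R}^{n+p}$ be a simply connected submanifold carrying a parallel flat normal subbundle $\mathcal{N}$ of rank $s$, and let $$f=\mathcal{R}^{\mathcal{N}}_w(h)\colon M^n=L^{n-s}\times\mathcal{N}^{\|}\to\mathbb{R}^{n+p}$$ be an $\mathcal{N}$-Ribaucour transform of $h$ determined by $w\in\mathcal{S}_{\mathcal{N}}(h)$ with $\mathcal{E}(w)=0$. Then the vector field $\eta(u,t)=\mathcal{P}_t\bar\beta(u)$ is a Dupin principal normal of $f$ with integrable conullity, the leaves of the conullity being parametrized by $f(\,\cdot\,,t_0)$ with $t_0\in\mathcal{N}^{\|}$.
   Context: For an isometric immersion $f$, $\alpha_f$ denotes its second fundamental form and $\nabla^\perp$ the normal connection. A smooth normal field $\eta$ is a principal normal of multiplicity $s\ge 1$ if the subspaces $\mathcal{E}_\eta=\{T:\alpha_f(T,X)=\langle T,X\rangle\eta\ \text{for all tangent } X\}$ have constant dimension $s$; it is Dupin if $\nabla^\perp_T\eta=0$ for all $T\in\mathcal{E}_\eta$. The orthogonal complement $\mathcal{E}_\eta^\perp$ in the tangent bundle is the conullity. $\mathcal{N}$ is parallel in the normal connection of $h$ and flat (normal curvature vanishes on $\mathcal{N}$). $\mathcal{N}^\perp$ is the orthogonal complement of $\mathcal{N}$ in $T_h^\perp L$, a subscript subspace denotes orthogonal projection, and $\mathcal{N}^{\|}$ is the $s$-dimensional vector space of parallel sections of $\mathcal{N}$. $\mathcal{S}(h)$ is the set of pairs $(\varphi,\beta)$, $\varphi\in C^\infty(L)$,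 $\beta$ a normal field of $h$, with $\alpha_h(\nabla\varphi,X)+\nabla^\perp_X\beta=0$ for all $X\in TL$ and $\varphi\,(h_*\nabla\varphi+\beta)\ne0$ everywhere. $\mathcal{S}_{\mathcal{N}}(h)$ is the set of classes $w=[(\varphi,\beta)]$ under: $(\varphi,\beta)\sim(\varphi',\beta')$ iff $\varphi'=\lambda\varphi$, $\beta'-\lambda\beta\in\mathcal{N}^{\|}$ for some real $\lambda\neq0$. For $t\in\mathcal{N}^{\|}$ put $\mathcal{F}_t=h_*\nabla\varphi+\beta+t$, $\nu_t=\|\mathcal{F}_t\|^{-2}$, $\mathcal{P}_t=I-2\nu_t\mathcal{F}_t\mathcal{F}_t^*$ (with $\mathcal{F}_t^*(Z)=\langle\mathcal{F}_t,Z\rangle$). The $\mathcal{N}$-Ribaucour transform $\mathcal{R}^{\mathcal{N}}_w(h)$ is the $n$-dimensional immersed submanifold parametrized, at regular points, by $f(u,t)=h(u)-2\varphi(u)\nu_t(u)\mathcal{F}_t(u)$, $(u,t)\in L\times\mathcal{N}^{\|}$. Finally $\bar\beta=-\varphi^{-1}\beta_{\mathcal{N}^\perp}$ and $\mathcal{E}(w)(x)=\{Z\in T_xL:\alpha_h(Z,X)_{\mathcal{N}^\perp}=\langle Z,X\rangle\bar\beta\ \text{for all }X\in T_xL\}$. *)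

(* Defs.v *)
(* Submanifold geometry in Euclidean space R^k = 'rV[R]_k, for maps defined on
   an abstract smooth manifold. The tangent space of a manifold modelled on V is
   identified, at each point x, with V itself by means of a preferred chart
   chart_at x around x. *)
From mathcomp Require Import all_boot all_order all_algebra.
From mathcomp Require Import all_classical all_reals all_analysis.

Set Implicit Arguments.
Unset Strict Implicit.
Unset Printing Implicit Defensive.

Import Order.TTheory GRing.Theory Num.Theory.
Import numFieldNormedType.Exports.

Local Open Scope classical_set_scope.
Local Open Scope ring_scope.

Section LinearAlgebra.
Context {R : realType}.

Definition dotv k (u v : 'rV[R]_k) : R := \sum_i u 0 i * v 0 i.

Definition is_basis (W : lmodType R) d (S : set W) (b : 'I_d -> W) : Prop :=
  (forall c : 'I_d -> R, \sum_i c i *: b i = 0 -> forall i, c i = 0) /\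
  S = [set \sum_i c i *: b i | c in [set: 'I_d -> R]].

Definition has_dim (W : lmodType R) (S : set W) (d : nat) : Prop :=
  exists b : 'I_d -> W, is_basis S b.

(* Orthogonal projection onto S, meant for linear subspaces only. *)
Definition oproj k (S : set 'rV[R]_k) (y : 'rV[R]_k) : 'rV[R]_k :=
  xget 0 [set z | S z /\ forall s, S s -> dotv (y - z) s = 0].

End LinearAlgebra.

Section SmoothManifolds.
Context {R : realType}.

(* For O open in a finite-dimensional V this is the class C^k: the iterated
   directional derivatives up to order k exist and are continuous on O. *)
Fixpoint Ck (V W : normedModType R) (k : nat) (O : set V) (f : V -> W) : Prop :=
  match k with
  | 0 => forall a, O a -> {for a, continuous f}
  | k'.+1 => (forall a, O a -> differentiable f a) /\
             forall v, Ck k' O ('D_v f)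
  end.

Definition Cinfty (V W : normedModType R) (O : set V) (f : V -> W) : Prop :=
  forall k, Ck k O f.

(* coord is a homeomorphism from the open set dom onto the open set cod, with
   inverse param; the values of coord outside dom and of param outside cod are
   irrelevant. *)
Record chart (V : normedModType R) (T : topologicalType) := Chart {
  coord : T -> V;
  param : V -> T;
  dom : set T;
  cod : set V;
  dom_open : open dom;
  cod_open : open cod;
  coord_cod : forall x, dom x -> cod (coord x);
  param_dom : forall a, cod a -> dom (param a);
  coordK : forall x, dom x -> param (coord x) = x;
  paramK : forall a, cod a -> coord (param a) = a;
  coord_continuous : forall x, dom x -> {for x, continuous coord};
  param_continuous : forall a, cod a -> {for a, continuous param}
}.

(* The atlas is the family of all the charts chart_at x. *)
Record charted (V : normedModType R) := Charted {
  carrier :> topologicalType;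
  chart_at : carrier -> chart V carrier;
  mem_chart_at : forall x, dom (chart_at x) x
}.

Definition smooth_manifold (V : normedModType R) (M : charted V) : Prop :=
  [/\ hausdorff_space M, @second_countable M &
      forall x y : M,
        Cinfty [set a | cod (chart_at x) a /\
                        dom (chart_at y) (param (chart_at x) a)]
               (coord (chart_at y) \o param (chart_at x))].

Definition simply_connected (T : topologicalType) : Prop :=
  (forall x y : T, exists g : R -> T,
     [/\ {within `[0, 1], continuous g}, g 0 = x & g 1 = y]) /\
  (forall (x : T) (g : R -> T),
     {within `[0, 1], continuous g} -> g 0 = x -> g 1 = x ->
     exists H : R * R -> T,
       [/\ {within `[0, 1] `*` `[0, 1], continuous H},
           forall a, a \in `[0, 1] -> H (0, a) = g a,
           forall a, a \in `[0, 1] -> H (1, a) = x &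
           forall a, a \in `[0, 1] -> H (a, 0) = x /\ H (a, 1) = x]).

Section Product.
Variables (V W : normedModType R) (M : charted V).

Definition prod_chart (x : M) : chart (V * W)%type (M * W)%type.
Proof.
refine (@Chart (V * W)%type (M * W)%type
  (fun q => (coord (chart_at x) q.1, q.2))
  (fun a => (param (chart_at x) a.1, a.2))
  (fst @^-1` dom (chart_at x)) (fst @^-1` cod (chart_at x)) _ _ _ _ _ _ _ _).
- apply: open_comp; [move=> q _; exact: cvg_fst|exact: dom_open].
- apply: open_comp; [move=> a _; exact: cvg_fst|exact: cod_open].
- by move=> q; exact: coord_cod.
- by move=> a; exact: param_dom.
- by move=> [y t] /= yd; rewrite coordK.
- by move=> [a t] /= ac; rewrite paramK.
- move=> [y t] /= yd; apply: cvg_pair => /=; last exact: cvg_snd.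
  apply: (@cvg_comp _ _ _ fst (coord (chart_at x)) _ (nbhs y)).
    exact: cvg_fst.
  exact: coord_continuous.
- move=> [a t] /= ac; apply: cvg_pair => /=; last exact: cvg_snd.
  apply: (@cvg_comp _ _ _ fst (param (chart_at x)) _ (nbhs a)).
    exact: cvg_fst.
  exact: param_continuous.
Defined.

Definition prod_charted : charted (V * W)%type :=
  @Charted (V * W)%type (M * W)%type
    (fun q => prod_chart q.1) (fun q => mem_chart_at q.1).

End Product.

Section Calculus.
Variables (V : normedModType R) (M : charted V).

Definition smooth_on (W : normedModType R) (U : set M) (F : M -> W) : Prop :=
  forall x, U x ->
    Cinfty [set a | cod (chart_at x) a /\ U (param (chart_at x) a)]
           (F \o param (chart_at x)).

(* Differential at x of a vector valued map, on T_x M = V. *)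
Definition dmap (W : normedModType R) (F : M -> W) (x : M) (v : V) : W :=
  'D_v (F \o param (chart_at x)) (coord (chart_at x) x).

End Calculus.

Section ManifoldMaps.
Variables (E V : normedModType R) (K : charted E) (M : charted V).

Definition local_expr (g : K -> M) (y : K) : E -> V :=
  coord (chart_at (g y)) \o g \o param (chart_at y).

Definition smooth_map (U : set K) (g : K -> M) : Prop :=
  forall y, U y ->
    {for y, continuous g} /\
    Cinfty [set a | [/\ cod (chart_at y) a, U (param (chart_at y) a) &
                        dom (chart_at (g y)) (g (param (chart_at y) a))]]
           (local_expr g y).

Definition mdiff (g : K -> M) (y : K) (v : E) : V :=
  'D_v (local_expr g y) (coord (chart_at y) y).

End ManifoldMaps.

End SmoothManifolds.

Arguments simply_connected R T : clear implicits.

(* Distributions are given by subspaces D x of T_x M = V, at the points x of an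
   open subset O of M. *)
Section Foliations.
Context {R : realType}.
Variables (V : normedModType R) (M : charted V) (O : set M) (D : M -> set V).

(* An integral manifold of D in O is an injective immersion g of a connected
   r-dimensional manifold, tangent to D. The source is an open connected subset U
   of a manifold K, which covers the case of all of K and avoids forming open
   submanifolds as separate types. *)
Definition integral_manifold r (K : charted 'rV[R]_r) (U : set K) (g : K -> M) :
    Prop :=
  [/\ smooth_manifold K, open U /\ (connected U /\ U !=set0),
      smooth_map U g, set_inj U g &
      forall y, U y ->
        [/\ O (g y), injective (mdiff g y) & range (mdiff g y) = D (g y)]].

Definition integrable_distribution r : Prop :=
  forall x, O x -> exists (K : charted 'rV[R]_r) (U : set K) (g : K -> M),
    integral_manifold U g /\ (g @` U) x.

(* Leaves are the maximal integral manifolds, regarded as subsets of O. *)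
Definition leaf r (S : set M) : Prop :=
  (exists (K : charted 'rV[R]_r) (U : set K) (g : K -> M),
     integral_manifold U g /\ S = g @` U) /\
  (forall (K : charted 'rV[R]_r) (U : set K) (g : K -> M),
     integral_manifold U g -> (S `&` g @` U) !=set0 -> g @` U `<=` S).

End Foliations.

Section Submanifolds.
Context {R : realType}.
Variables (V : normedModType R) (M : charted V) (k : nat) (f : M -> 'rV[R]_k).

Definition immersion_on (O : set M) : Prop :=
  smooth_on O f /\ forall x, O x -> injective (dmap f x).

Definition metric (x : M) (v w : V) : R := dotv (dmap f x v) (dmap f x w).

Definition normal_space (x : M) : set 'rV[R]_k :=
  [set y | forall v, dotv (dmap f x v) y = 0].

Definition nproj (x : M) : 'rV[R]_k -> 'rV[R]_k := oproj (normal_space x).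

(* Gauss formula: the vector w in T_x M is extended by the vector field that is
   constant in the chart at x. *)
Definition sff (x : M) (v w : V) : 'rV[R]_k :=
  nproj x ('D_v ('D_w (f \o param (chart_at x))) (coord (chart_at x) x)).

Definition nabla_perp (xi : M -> 'rV[R]_k) (x : M) (v : V) : 'rV[R]_k :=
  nproj x (dmap xi x v).

(* The covariant derivative of xi along the coordinate field w of the chart at x,
   as a function of the coordinates. *)
Definition nabla_perp_coord (xi : M -> 'rV[R]_k) (x : M) (w : V) (a : V) :
    'rV[R]_k :=
  nproj (param (chart_at x) a) ('D_w (xi \o param (chart_at x)) a).

(* Coordinate fields commute, whence no bracket term. *)
Definition normal_curvature (x : M) (v w : V) (xi : M -> 'rV[R]_k) : 'rV[R]_k :=
  nproj x ('D_v (nabla_perp_coord xi x w) (coord (chart_at x) x)) -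
  nproj x ('D_w (nabla_perp_coord xi x v) (coord (chart_at x) x)).

(* Intrinsic gradient with respect to the metric induced by f; the ambient vector
   f_* grad phi is dmap f x (gradient phi x). *)
Definition gradient (phi : M -> R) (x : M) : V :=
  xget 0 [set g | forall v, metric x g v = dmap phi x v].

Definition Edistr (eta : M -> 'rV[R]_k) (x : M) : set V :=
  [set T | forall X, sff x T X = metric x T X *: eta x].

Definition conullity (eta : M -> 'rV[R]_k) (x : M) : set V :=
  [set X | forall T, Edistr eta x T -> metric x T X = 0].

Definition principal_normal (O : set M) (eta : M -> 'rV[R]_k) (d : nat) : Prop :=
  [/\ (0 < d)%N, smooth_on O eta, forall x, O x -> normal_space x (eta x) &
      forall x, O x -> has_dim (Edistr eta x) d].

Definition dupin_principal_normal (O : set M) (eta : M -> 'rV[R]_k) (d : nat) :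
    Prop :=
  principal_normal O eta d /\
  forall x, O x -> forall T, Edistr eta x T -> nabla_perp eta x T = 0.

Section NormalSubbundle.
Variable N : M -> set 'rV[R]_k.

Definition section_on (U : set M) (xi : M -> 'rV[R]_k) : Prop :=
  smooth_on U xi /\ forall x, U x -> N x (xi x).

Definition normal_subbundle (d : nat) : Prop :=
  (forall x, N x `<=` normal_space x) /\
  (forall x, exists (U : set M) (e : 'I_d -> M -> 'rV[R]_k),
     [/\ open U, U x, forall i, smooth_on U (e i) &
         forall y, U y -> is_basis (N y) (fun i => e i y)]).

Definition parallel_subbundle : Prop :=
  forall (U : set M) xi, open U -> section_on U xi ->
  forall x, U x -> forall v, N x (nabla_perp xi x v).

Definition flat_subbundle : Prop :=
  forall (U : set M) xi, open U -> section_on U xi ->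
  forall x, U x -> forall v w, normal_curvature x v w xi = 0.

Definition parallel_sections : set (M -> 'rV[R]_k) :=
  [set xi | section_on setT xi /\ forall x v, nabla_perp xi x v = 0].

Definition Nperp (x : M) : set 'rV[R]_k :=
  [set y | normal_space x y /\ forall z, N x z -> dotv z y = 0].

End NormalSubbundle.

End Submanifolds.

Section Ribaucour.
Context {R : realType}.
Variables (V : normedModType R) (L : charted V) (k : nat) (h : L -> 'rV[R]_k).

(* In this section t is a section of N, (phi, beta) an element of S(h), and
   Rib_F is F_t, Rib_nu is nu_t, Rib_P is P_t. *)
Definition Rib_F (phi : L -> R) (beta t : L -> 'rV[R]_k) (u : L) : 'rV[R]_k :=
  dmap h u (gradient h phi u) + beta u + t u.

Definition Rib_nu phi beta t u : R :=
  (dotv (Rib_F phi beta t u) (Rib_F phi beta t u))^-1.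

Definition Rib_P phi beta t u (Z : 'rV[R]_k) : 'rV[R]_k :=
  Z - (2 * Rib_nu phi beta t u * dotv (Rib_F phi beta t u) Z)
        *: Rib_F phi beta t u.

Definition Rib_map phi beta t u : 'rV[R]_k :=
  h u - (2 * phi u * Rib_nu phi beta t u) *: Rib_F phi beta t u.

(* S(h) *)
Definition Rib_pairs : set ((L -> R) * (L -> 'rV[R]_k)) :=
  [set p | [/\ smooth_on setT p.1,
      smooth_on setT p.2 /\ (forall x, normal_space h x (p.2 x)),
      forall x v, sff h x (gradient h p.1 x) v + nabla_perp h p.2 x v = 0 &
      forall x, p.1 x *: (dmap h x (gradient h p.1 x) + p.2 x) != 0]].

Variable N : L -> set 'rV[R]_k.

Definition Rib_equiv (p q : (L -> R) * (L -> 'rV[R]_k)) : Prop :=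
  exists lambda : R, [/\ lambda != 0, q.1 = (fun x => lambda * p.1 x) &
    parallel_sections h N (fun x => q.2 x - lambda *: p.2 x)].

(* S_N(h) *)
Definition Rib_classes : set (set ((L -> R) * (L -> 'rV[R]_k))) :=
  [set w | exists2 p, Rib_pairs p & w = [set q | Rib_pairs q /\ Rib_equiv p q]].

Definition beta_bar (phi : L -> R) (beta : L -> 'rV[R]_k) (x : L) : 'rV[R]_k :=
  - (phi x)^-1 *: oproj (Nperp h N x) (beta x).

(* E(w), computed with a representative (phi, beta) of w; beta_bar is the same
   for all representatives. *)
Definition Ew phi beta (x : L) : set V :=
  [set Z | forall X, oproj (Nperp h N x) (sff h x Z X) =
                     metric h x Z X *: beta_bar phi beta x].

(* The N-Ribaucour transform, on L x R^d, where tau is a linear identification of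
   R^d with the space of parallel sections of N. *)
Variables (d : nat) (tau : 'rV[R]_d -> L -> 'rV[R]_k).

Definition Rib_transform phi beta (q : prod_charted 'rV[R]_d L) : 'rV[R]_k :=
  Rib_map phi beta (tau q.2) q.1.

(* Where F_t vanishes the parametrization is undefined (Rib_map takes the value h
   there by convention), so such points are not regular. *)
Definition Rib_regular phi beta : set (prod_charted 'rV[R]_d L) :=
  [set q | Rib_F phi beta (tau q.2) q.1 != 0 /\
           injective (dmap (Rib_transform phi beta) q)].

Definition Rib_eta phi beta (q : prod_charted 'rV[R]_d L) : 'rV[R]_k :=
  Rib_P phi beta (tau q.2) q.1 (beta_bar phi beta q.1).

End Ribaucour.

(* Main.v *)
From HB Require Import structures.
Require Import Defs.
From mathcomp Require Import all_boot all_order all_algebra.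
From mathcomp Require Import all_classical all_reals all_analysis.
From mathcomp Require Import ring.

(** Write [F = h_* grad phi + beta + t], let [P] be the reflection in the hyperplane
    orthogonal to [F], and put [c = 2 phi / |F|^2], so that [f = h - c F].

    The equation defining the pair [(phi, beta)] says that the differential of
    [h_* grad phi + beta] is tangent to [h] ([grad_beta_tangent]; this uses the
    symmetry of the second derivatives of [h], [schwarz]). As [t] is a parallel
    section, [dF] is then tangent to [h] along [L]. Since [phi] is a potential of the
    form [<F, dh>], differentiating [f] gives
      [df (v, w) = P (dh v - c dF v - c w)]
    ([derive_ribaucour], [dmap_transform]). At a regular point the linear map
    [v |-> dh v - c dF v] is injective into the tangent space of [h], hence onto it, and
    the normal space of [f] is [P (N^perp)] ([normal_transform]). In particular
    [eta = P beta_bar] is normal to [f].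

    For a section [xi] of [N^perp] one has [<dF, xi> = 0], whence
      [d (P xi) (v, w) = P (d xi v + c <beta_bar, xi> (dF v + w))]
    ([derive_refl], [dmap_reflected]). Since [P] is an isometry, pairing this with [df]
    makes the terms with [dF] and [w] cancel against the metric of [f]:
      [<alpha_f (Z, W) - <Z, W> eta, P xi> = <alpha_h (v, y') - <v, y'> beta_bar, xi>]
    where [v] is the first component of [Z] and [y'] is a tangent vector of [L] that
    depends on [W] only and takes all values ([sff_minus_metric]). So [Z] belongs to the principal
    distribution of [eta] if and only if [v] belongs to [E(w) = 0]: this distribution is
    tangent to the second factor ([Edistr_transform]). The formula for [d (P xi)] with
    [xi = beta_bar] and [v = 0] shows that [d eta (0, w)] is tangent to [f], which is the
    Dupin condition ([eta_dupin]). The two factors are orthogonal for the metric of [f],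
    so that the conullity is tangent to the slices with constant [t]
    ([conullity_transform]). A map tangent to the conullity has a second component
    with zero differential, hence constant; this identifies the leaves with the
    connected components of the slices of the set of regular points
    ([integral_sub_leaf], [leaf_transformP]).

    Smoothness of the gradient, of the projection onto [N^perp] and of [eta] comes
    from expressing orthogonal projections by inverses of Gram matrices ([rowproj]).
    Finally, parallel sections have constant length, so that evaluation at a point
    identifies them with the fibre of [N] ([parallel_eq0], [parallel_onto]). *)

Set Implicit Arguments.
Unset Strict Implicit.
Unset Printing Implicit Defensive.

Import Order.TTheory GRing.Theory Num.Theory.
Import numFieldNormedType.Exports.

Local Open Scope classical_set_scope.
Local Open Scope ring_scope.

Local Notation coord := Defs.coord.
Local Notation normal_space := Defs.normal_space.

(** * Smooth maps between normed modules *)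

Section Derivatives.
Context {R : realType} {V : normedModType R}.

Lemma eq_on_near (T : topologicalType) (U : Type) (O : set T) (f g : T -> U) a :
  open O -> O a -> (forall b, O b -> f b = g b) -> \near a, f a = g a.
Proof. by move=> oO Oa fg; near=> b; apply: fg; near: b; exact: open_nbhs_nbhs.
Unshelve. all: by end_near. Qed.

Lemma derive_on (W : normedModType R) (O : set V) (f g : V -> W) a v :
  open O -> O a -> (forall b, O b -> f b = g b) -> 'D_v f a = 'D_v g a.
Proof. by move=> oO Oa fg; apply: near_eq_derive; exact: eq_on_near fg. Qed.

Lemma near_eq_differentiable (W : normedModType R) (f g : V -> W) a :
  (\near a, f a = g a) -> differentiable f a -> differentiable g a.
Proof.
move=> fg df; apply/diff_locallyP.
have [dfc /eqaddoP dfe] := (diff_locallyP _ _).1 df.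
have ge : g \o shift a = cst (g a) + 'd f a +o_ (0 : V) id.
  apply/eqaddoP => e e0; have nfg : \forall x \near (0 : V), f (x + a) = g (x + a).
    by have := fg; rewrite (near_shift 0) /=; apply: filterS => x /=; rewrite subr0.
  apply: filterS2 nfg (dfe _ e0) => x fgx.
  suff -> : (g \o shift a - (cst (g a) + 'd f a)) x =
            (f \o shift a - (cst (f a) + 'd f a)) x by [].
  change (g (x + a) - (g a + 'd f a x) = f (x + a) - (f a + 'd f a x)).
  by rewrite fgx (nbhs_singleton fg).
by rewrite (diff_unique dfc ge).
Qed.

Lemma differentiable_on (W : normedModType R) (O : set V) (f g : V -> W) a :
  open O -> O a -> (forall b, O b -> f b = g b) ->
  differentiable f a -> differentiable g a.
Proof. by move=> oO Oa fg; apply: near_eq_differentiable; exact: eq_on_near fg. Qed.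

Lemma differentiable_mxP m n (f : V -> 'M[R]_(m, n)) a :
  (forall i j, differentiable (fun x => f x i j) a) -> differentiable f a.
Proof.
move=> df; rewrite (_ : f = \sum_i \sum_j (fun x => f x i j *: delta_mx i j)).
  by do 2!apply: differentiable_sum => ?; exact: differentiableZl.
apply/funext => x; rewrite fct_sumE [LHS]matrix_sum_delta.
by apply: eq_bigr => i _; rewrite fct_sumE.
Qed.

Lemma differentiable_entry m n (f : V -> 'M[R]_(m, n)) a i j :
  differentiable f a -> differentiable (fun x => f x i j) a.
Proof.
move=> df; apply: (@differentiable_comp _ _ _ _ f (fun M : 'M[R]_(m, n) => M i j)) => //.
exact: differentiable_coord.
Qed.

Lemma derive_entry m n (f : V -> 'M[R]_(m, n)) a v i j :
  differentiable f a -> 'D_v f a i j = 'D_v (fun x => f x i j) a.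
Proof. by move=> df; rewrite derive_mx ?mxE//; exact: diff_derivable. Qed.

Lemma derive_comp (V' W : normedModType R) (g : V' -> W) (f : V -> V') a v :
  differentiable f a -> differentiable g (f a) ->
  'D_v (g \o f) a = 'D_('D_v f a) g (f a).
Proof.
move=> df dg; rewrite !deriveE//; last exact: differentiable_comp.
by rewrite diff_comp.
Qed.

Lemma derive_is_linear (W : normedModType R) (f : V -> W) a c u v :
  differentiable f a -> 'D_(c *: u + v) f a = c *: 'D_u f a + 'D_v f a.
Proof. by move=> df; rewrite !deriveE// linearP. Qed.

Lemma derive_linear (W : normedModType R) (f : {linear V -> W}) a v :
  continuous f -> 'D_v f a = f v.
Proof.
by move=> cf; rewrite deriveE; [rewrite diff_lin | exact: linear_differentiable].
Qed.

End Derivatives.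

Section CkCalculus.
Context {R : realType} {V : normedModType R}.
Implicit Types (O : set V) (k : nat).

Lemma Ck_ext (W : normedModType R) k O (f g : V -> W) :
  open O -> (forall a, O a -> f a = g a) -> Ck k O f -> Ck k O g.
Proof.
move=> oO; elim: k f g => [|k IH] f g fg /=.
  move=> cf a Oa; rewrite /prop_for /continuous_at -(fg a Oa).
  apply: cvg_trans (cf a Oa); apply: near_eq_cvg; apply: (eq_on_near oO Oa) => b Ob.
  by rewrite fg.
move=> [df Df]; split=> [a Oa|v]; first exact: (differentiable_on oO Oa fg (df a Oa)).
by apply: IH (Df v) => a Oa; exact: derive_on fg.
Qed.

Lemma Ck_sub (W : normedModType R) k O O' (f : V -> W) :
  O' `<=` O -> Ck k O f -> Ck k O' f.
Proof.
move=> OO'; elim: k f => [|k IH] f /=; first by move=> cf a /OO'; exact: cf.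
by move=> [df Df]; split=> [a /OO'|v]; [exact: df|exact: IH].
Qed.

Lemma CkS (W : normedModType R) k O (f : V -> W) : Ck k.+1 O f -> Ck k O f.
Proof.
elim: k f => [|k IH] f [df Df].
  by move=> a Oa; apply: differentiable_continuous; exact: df.
by split=> // v; apply: IH; exact: Df.
Qed.

Lemma Ck_cst (W : normedModType R) k O (c : W) : Ck k O (fun=> c).
Proof.
elim: k c => [|k IH] c /=; first by move=> a _; exact: cvg_cst.
split=> [a _|v]; first exact: differentiable_cst.
by rewrite (_ : 'D_v _ = fun=> 0)//; apply/funext => a; exact: derive_cst.
Qed.

Lemma Ck_linear (W : normedModType R) k O (f : {linear V -> W}) :
  continuous f -> Ck k O f.
Proof.
move=> cf; case: k => [|k] /=; first by move=> a _; exact: cf.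
split=> [a _|v]; first exact: linear_differentiable.
rewrite (_ : 'D_v _ = fun=> f v); first exact: Ck_cst.
by apply/funext => a; exact: derive_linear.
Qed.

Lemma CkD (W : normedModType R) k O (f g : V -> W) : open O ->
  Ck k O f -> Ck k O g -> Ck k O (fun x => f x + g x).
Proof.
move=> oO; elim: k f g => [|k IH] f g /=.
  by move=> cf cg a Oa; apply: cvgD; [exact: cf|exact: cg].
move=> [df Df] [dg Dg]; split=> [a Oa|v].
  by apply: differentiableD; [exact: df|exact: dg].
apply: (Ck_ext oO _ (IH _ _ (Df v) (Dg v))) => a Oa; apply/esym.
by apply: deriveD; apply: diff_derivable; [exact: df|exact: dg].
Qed.

Lemma CkM k O (f g : V -> R) : open O ->
  Ck k O f -> Ck k O g -> Ck k O (fun x => f x * g x).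
Proof.
move=> oO; elim: k f g => [|k IH] f g.
  by move=> cf cg a Oa; apply: cvgM; [exact: cf|exact: cg].
move=> cf cg; have [df Df] := cf; have [dg Dg] := cg; split=> [a Oa|v].
  by apply: differentiableM; [exact: df|exact: dg].
apply: (Ck_ext oO _ (CkD oO (IH _ _ (CkS cf) (Dg v)) (IH _ _ (CkS cg) (Df v)))).
move=> a Oa; apply/esym.
by apply: deriveM; apply: diff_derivable; [exact: df|exact: dg].
Qed.

Lemma CkV k O (f : V -> R) : open O -> (forall a, O a -> f a != 0) ->
  Ck k O f -> Ck k O (fun x => (f x)^-1).
Proof.
move=> oO f0; elim: k => [|k IH].
  by move=> cf a Oa; apply: cvgV; [exact: f0|exact: cf].
move=> cf; have [df Df] := cf; split=> [a Oa|v].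
  by apply: differentiableV; [exact: df|exact: f0].
have cV := IH (CkS cf).
have cD := CkM oO (Ck_cst k O (-1 : R)) (CkM oO (CkM oO cV cV) (Df v)).
apply: (@Ck_ext R k O _ _ oO _ cD).
move=> a Oa; apply/esym; rewrite [LHS]deriveV ?f0//; last first.
  by apply: diff_derivable; exact: df.
by rewrite -invfM -expr2 mulN1r scaleNr.
Qed.

(** With smoothness checked on entries, the cases of products, determinants and
    inverses of matrices reduce to sums and products of scalar functions. *)
Lemma Ck_mx k O m n (f : V -> 'M[R]_(m, n)) : open O ->
  (forall i j, Ck k O (fun x => f x i j)) -> Ck k O f.
Proof.
move=> oO; elim: k f => [|k IH] f cf.
  move=> a Oa; apply/cvgrPdist_le => /= e e0; near=> x.
  rewrite [leLHS]/Num.Def.normr/= mx_normrE (bigmax_le _ (ltW e0))//= => i _.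
  rewrite !mxE; move: i; near: x; apply: filter_forall => /= i.
  by move/cvgrPdist_le : (cf i.1 i.2 a Oa); apply.
have df a : O a -> differentiable f a.
  by move=> Oa; apply: differentiable_mxP => i j; have [+ _] := cf i j; apply.
split=> // v; apply: IH => i j; have [_ /(_ v)] := cf i j.
by apply: Ck_ext => // a Oa; rewrite derive_entry//; exact: df.
Unshelve. all: by end_near. Qed.

Lemma Ck_entry k O m n (f : V -> 'M[R]_(m, n)) i j : open O ->
  Ck k O f -> Ck k O (fun x => f x i j).
Proof.
move=> oO; elim: k f => [|k IH] f.
  move=> cf a Oa; apply: (@continuous_comp _ _ _ f (fun M : 'M[R]_(m, n) => M i j)).
    exact: cf.
  exact: coord_continuous.
move=> [df Df]; split=> [a Oa|v]; first exact: differentiable_entry (df a Oa).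
by apply: (Ck_ext oO _ (IH _ (Df v))) => a Oa; exact: derive_entry (df a Oa).
Qed.

End CkCalculus.

Section CkProduct.
Context {R : realType} {V V' : normedModType R}.

Lemma differentiable_fst (a : V * V') : differentiable fst a.
Proof. by apply: linear_differentiable => x; exact: cvg_fst. Qed.

Lemma differentiable_snd (a : V * V') : differentiable snd a.
Proof. by apply: linear_differentiable => x; exact: cvg_snd. Qed.

Lemma derive_fst (W : normedModType R) (f : V -> W) (a w : V * V') :
  differentiable f a.1 -> 'D_w (f \o fst) a = 'D_(w.1) f a.1.
Proof.
move=> df; rewrite derive_comp//; last exact: differentiable_fst.
by rewrite derive_linear// => x; exact: cvg_fst.
Qed.

Lemma open_fst (O : set V) : open O -> open (@fst V V' @^-1` O).
Proof. by apply: open_comp => x _; exact: cvg_fst. Qed.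

Lemma Ck_fst (W : normedModType R) k (O : set V) (f : V -> W) :
  open O -> Ck k O f -> Ck k (fst @^-1` O) (fun a : V * V' => f a.1).
Proof.
move=> oO; elim: k f => [|k IH] f.
  move=> cf a Oa; apply: (@continuous_comp _ _ _ (@fst V V') f); first exact: cvg_fst.
  exact: cf.
move=> [df Df]; split=> [a Oa|w].
  by apply: differentiable_comp (differentiable_fst a) _; exact: df.
apply: (Ck_ext (open_fst oO) _ (IH _ (Df w.1))) => a Oa.
by apply/esym; apply: derive_fst; exact: df.
Qed.

End CkProduct.

Section Cinfty.
Context {R : realType} {V : normedModType R} (O : set V) (oO : open O).

Lemma Cinfty_ext (W : normedModType R) (f g : V -> W) :
  (forall a, O a -> f a = g a) -> Cinfty O f -> Cinfty O g.
Proof. by move=> fg cf k; exact: Ck_ext (cf k). Qed.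

Lemma Cinfty_sub (W : normedModType R) O' (f : V -> W) :
  O' `<=` O -> Cinfty O f -> Cinfty O' f.
Proof. by move=> OO' cf k; exact: Ck_sub (cf k). Qed.

Lemma Cinfty_derive (W : normedModType R) (f : V -> W) v :
  Cinfty O f -> Cinfty O ('D_v f).
Proof. by move=> cf k; have [_] := cf k.+1; exact. Qed.

Lemma Cinfty_differentiable (W : normedModType R) (f : V -> W) a :
  Cinfty O f -> O a -> differentiable f a.
Proof. by move=> cf; have [+ _] := cf 1%N; exact. Qed.

Lemma Cinfty_continuous (W : normedModType R) (f : V -> W) a :
  Cinfty O f -> O a -> {for a, continuous f}.
Proof. by move=> cf; exact: (cf 0%N). Qed.

Lemma Cinfty_cst (W : normedModType R) (c : W) : Cinfty O (fun=> c).
Proof. by move=> k; exact: Ck_cst. Qed.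

Lemma CinftyD (W : normedModType R) (f g : V -> W) :
  Cinfty O f -> Cinfty O g -> Cinfty O (fun x => f x + g x).
Proof. by move=> cf cg k; exact: CkD. Qed.

Lemma CinftyM (f g : V -> R) :
  Cinfty O f -> Cinfty O g -> Cinfty O (fun x => f x * g x).
Proof. by move=> cf cg k; exact: CkM. Qed.

Lemma CinftyV (f : V -> R) : (forall a, O a -> f a != 0) ->
  Cinfty O f -> Cinfty O (fun x => (f x)^-1).
Proof. by move=> f0 cf k; exact: CkV. Qed.

Lemma Cinfty_sum (W : normedModType R) (I : Type) (r : seq I) (P : pred I)
    (f : I -> V -> W) :
  (forall i, Cinfty O (f i)) -> Cinfty O (fun x => \sum_(i <- r | P i) f i x).
Proof.
move=> cf; elim: r => [|i r IH].
  by apply: Cinfty_ext (Cinfty_cst 0) => a _; rewrite big_nil.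
apply: (Cinfty_ext (f := fun x =>
    (if P i then f i x else 0) + \sum_(j <- r | P j) f j x)).
  by move=> a _; rewrite big_cons; case: (P i); rewrite ?add0r.
by apply: CinftyD IH; case: (P i) => //; exact: Cinfty_cst.
Qed.

Lemma Cinfty_prod (I : Type) (r : seq I) (P : pred I) (f : I -> V -> R) :
  (forall i, Cinfty O (f i)) -> Cinfty O (fun x => \prod_(i <- r | P i) f i x).
Proof.
move=> cf; elim: r => [|i r IH].
  by apply: (@Cinfty_ext R) (Cinfty_cst (1 : R)) => a _; rewrite big_nil.
apply: (@Cinfty_ext R (fun x =>
    (if P i then f i x else 1) * \prod_(j <- r | P j) f j x)).
  by move=> a _; rewrite big_cons; case: (P i); rewrite ?mul1r.
by apply: CinftyM IH; case: (P i) => //; exact: Cinfty_cst.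
Qed.

Lemma Cinfty_mx m n (f : V -> 'M[R]_(m, n)) :
  (forall i j, Cinfty O (fun x => f x i j)) -> Cinfty O f.
Proof. by move=> cf k; apply: Ck_mx => // i j; exact: cf. Qed.

Lemma Cinfty_entry m n (f : V -> 'M[R]_(m, n)) i j :
  Cinfty O f -> Cinfty O (fun x => f x i j).
Proof. by move=> cf k; exact: Ck_entry. Qed.

Lemma CinftyZ m n (c : V -> R) (f : V -> 'M[R]_(m, n)) :
  Cinfty O c -> Cinfty O f -> Cinfty O (fun x => c x *: f x).
Proof.
move=> cc cf; apply: Cinfty_mx => i j.
apply: (@Cinfty_ext R (fun x => c x * f x i j)) => [a _|]; first by rewrite mxE.
by apply: CinftyM => //; exact: Cinfty_entry.
Qed.

Lemma CinftyN m n (f : V -> 'M[R]_(m, n)) :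
  Cinfty O f -> Cinfty O (fun x => - f x).
Proof.
move=> cf; apply: Cinfty_ext (CinftyZ (Cinfty_cst (-1 : R)) cf) => a _.
by rewrite scaleN1r.
Qed.

Lemma CinftyB m n (f g : V -> 'M[R]_(m, n)) :
  Cinfty O f -> Cinfty O g -> Cinfty O (fun x => f x - g x).
Proof. by move=> cf cg; apply: CinftyD => //; exact: CinftyN. Qed.

Lemma Cinfty_mulmx m n p (f : V -> 'M[R]_(m, n)) (g : V -> 'M[R]_(n, p)) :
  Cinfty O f -> Cinfty O g -> Cinfty O (fun x => f x *m g x).
Proof.
move=> cf cg; apply: Cinfty_mx => i j.
apply: (@Cinfty_ext R (fun x => \sum_k f x i k * g x k j)) => [a _|].
  by rewrite mxE.
by apply: Cinfty_sum => k; apply: CinftyM; exact: Cinfty_entry.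
Qed.

Lemma Cinfty_trmx m n (f : V -> 'M[R]_(m, n)) :
  Cinfty O f -> Cinfty O (fun x => (f x)^T).
Proof.
move=> cf; apply: Cinfty_mx => i j.
by apply: (@Cinfty_ext R) (Cinfty_entry j i cf) => a _; rewrite mxE.
Qed.

Lemma Cinfty_det n (f : V -> 'M[R]_n) :
  Cinfty O f -> Cinfty O (fun x => \det (f x)).
Proof.
move=> cf; apply: Cinfty_sum => s; apply: CinftyM; first exact: Cinfty_cst.
by apply: Cinfty_prod => i; exact: Cinfty_entry.
Qed.

(** Cramer: the entries of the inverse are polynomials over the determinant. *)
Lemma Cinfty_invmx n (f : V -> 'M[R]_n) : (forall a, O a -> f a \in unitmx) ->
  Cinfty O f -> Cinfty O (fun x => invmx (f x)).
Proof.
move=> fu cf.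
apply: (Cinfty_ext (f := fun x => (\det (f x))^-1 *: \adj (f x))) => [a Oa|].
  by rewrite /invmx fu.
apply: CinftyZ.
  apply: CinftyV; last exact: Cinfty_det.
  by move=> a /fu; rewrite unitmxE unitfE.
apply: Cinfty_mx => i j.
apply: (@Cinfty_ext R (fun x => (-1) ^+ (j + i) * \det (row' j (col' i (f x))))).
  by move=> a _; rewrite mxE.
apply: CinftyM; first exact: Cinfty_cst.
apply: Cinfty_det; apply: Cinfty_mx => k l.
by apply: (@Cinfty_ext R) (Cinfty_entry (lift j k) (lift i l) cf) => a _; rewrite !mxE.
Qed.

Lemma Cinfty_dotv k (f g : V -> 'rV[R]_k) :
  Cinfty O f -> Cinfty O g -> Cinfty O (fun x => dotv (f x) (g x)).
Proof.
by move=> cf cg; apply: Cinfty_sum => i; apply: CinftyM; exact: Cinfty_entry.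
Qed.

End Cinfty.

(** * Mean value theorem and symmetry of second derivatives *)

Section MeanValue.
Context {R : realType} {V : normedModType R}.

Lemma differentiable_line (p v : V) (x : R) :
  differentiable (fun y : R => p + y *: v) x.
Proof. by apply: differentiableD => //; exact: differentiableZl. Qed.

Lemma derive_line (p v : V) (x : R) : 'D_1 (fun y : R => p + y *: v) x = v.
Proof.
rewrite deriveD; [|exact: derivable_cst|]; last first.
  by apply: diff_derivable; exact: differentiableZl.
by rewrite derive_cst add0r deriveE ?diffZl// ?diff_val ?scale1r//; exact: differentiableZl.
Qed.

Lemma is_derive_line (f : V -> R) (p v : V) (x : R) :
  differentiable f (p + x *: v) ->
  is_derive x 1 (fun y : R => f (p + y *: v)) ('D_v f (p + x *: v)).
Proof.
move=> df; have dl := differentiable_line p v x; split.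
  by apply: diff_derivable; exact: differentiable_comp dl df.
by rewrite (derive_comp (f := fun y : R => p + y *: v)) // derive_line.
Qed.

Lemma mean_value_line (f : V -> R) (p v : V) (s : R) : 0 < s ->
  (forall x, 0 <= x <= s -> differentiable f (p + x *: v)) ->
  exists2 x, 0 < x < s & f (p + s *: v) - f p = s * 'D_v f (p + x *: v).
Proof.
move=> s0 df.
have [x|x|x] := @MVT R (fun y => f (p + y *: v)) (fun y => 'D_v f (p + y *: v)) 0 s s0.
- by rewrite in_itv /= => /andP[x0 xs]; apply: is_derive_line; apply: df; rewrite !ltW.
- apply: derivable_within_continuous => y; rewrite in_itv /= => ys.
  by have [] := is_derive_line (df y ys).
- rewrite in_itv /= => xs; rewrite scale0r addr0 subr0 => ->.
  by exists x => //; rewrite mulrC.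
Qed.

(** The mean value theorem is applied along [v] to [p |-> f (p + s w) - f p], and then
    along [w] to [D_v f]. *)
Lemma second_difference (f : V -> R) (O : set V) (a v w : V) (s : R) : 0 < s ->
  (forall x y : R, 0 <= x <= s -> 0 <= y <= s -> O (a + x *: v + y *: w)) ->
  Ck 2 O f ->
  exists x y, [/\ 0 < x < s, 0 < y < s &
    f (a + s *: v + s *: w) - f (a + s *: v) - (f (a + s *: w) - f a) =
    s * (s * 'D_w ('D_v f) (a + x *: v + y *: w))].
Proof.
move=> s0 Obox [df Df].
have sb : 0 <= s <= s by rewrite lexx ltW.
have zb : 0 <= (0 : R) <= s by rewrite lexx ltW.
pose g p := f (p + s *: w) - f p.
have dsh x : differentiable (fun p : V => p + s *: w) x.
  by apply: differentiableD => //; exact: differentiable_id.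
have Oa x : 0 <= x <= s -> O (a + x *: v).
  by move=> xs; have := Obox x 0 xs zb; rewrite scale0r addr0.
have dg1 x : 0 <= x <= s -> differentiable (fun p => f (p + s *: w)) (a + x *: v).
  move=> xs; apply: (@differentiable_comp _ _ _ _ (fun p : V => p + s *: w) f) => //.
  by apply: df; exact: Obox.
have dg2 x : 0 <= x <= s -> differentiable f (a + x *: v) by move=> /Oa; exact: df.
have [x xs gE] : exists2 x, 0 < x < s & g (a + s *: v) - g a = s * 'D_v g (a + x *: v).
  apply: (@mean_value_line g a v s s0) => y ys.
  by apply: differentiableB; [exact: dg1|exact: dg2].
have xs' : 0 <= x <= s by case/andP: xs => *; rewrite !ltW.
have [y ys DE] : exists2 y, 0 < y < s &
    'D_v f (a + x *: v + s *: w) - 'D_v f (a + x *: v) =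
    s * 'D_w ('D_v f) (a + x *: v + y *: w).
  apply: (@mean_value_line ('D_v f) (a + x *: v) w s s0) => y ys.
  by apply: (Df v).1; exact: Obox.
exists x, y; split; [exact: xs|exact: ys|rewrite -DE].
apply: etrans gE _; congr (_ * _).
rewrite deriveB; [|exact: diff_derivable (dg1 _ xs')|exact: diff_derivable (dg2 _ xs')].
apply: (congr1 (fun z => z - _)).
rewrite (derive_comp (f := fun p : V => p + s *: w))//; last by apply: df; exact: Obox.
rewrite deriveD; [|exact: derivable_id|exact: derivable_cst].
by rewrite derive_cst addr0 derive_id.
Qed.

Lemma eq_of_near_values (F G : V -> R) (a : V) :
  {for a, continuous F} -> {for a, continuous G} ->
  (forall r, 0 < r -> exists b c, [/\ ball a r b, ball a r c & F b = G c]) ->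
  F a = G a.
Proof.
move=> cF cG FG.
apply/eqP; rewrite -subr_eq0 -normr_le0; apply/ler_addgt0Pr => e e0; rewrite add0r.
have e20 : 0 < e / 2 by rewrite divr_gt0.
move/cvgrPdist_lt : cF => /(_ _ e20) nF; move/cvgrPdist_lt : cG => /(_ _ e20) nG.
have /nbhs_ballP[r /= r0 rP] : \forall b \near a,
    `|F a - F b| < e / 2 /\ `|G a - G b| < e / 2 by exact: filterI nF nG.
have [b [c [/rP[Fb _] /rP[_ Gc] FbGc]]] := FG r r0.
rewrite /= in Fb Gc; rewrite (_ : F a - G a = (F a - F b) + (G c - G a)); last first.
  by rewrite FbGc addrA subrK.
by rewrite (le_trans (ler_normD _ _))// [leRHS]splitr lerD// ltW// distrC.
Qed.

(** Symmetry of second derivatives: the second difference over a small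
    parallelogram is a value of either mixed derivative in it. *)
Lemma schwarz (f : V -> R) (O : set V) (a v w : V) : open O -> O a ->
  Ck 2 O f -> 'D_w ('D_v f) a = 'D_v ('D_w f) a.
Proof.
move=> oO Oa cf; have [_ Df] := cf.
apply: (@eq_of_near_values _ _ a ((Df v).2 w a Oa) ((Df w).2 v a Oa)) => r' r'0.
have /nbhs_ballP[r /= r0 rO] : nbhs a (ball a r' `&` O).
  by apply: filterI; [exact: nbhsx_ballx|exact: open_nbhs_nbhs].
(* The size [s] keeps the parallelogram in the ball; [1] avoids dividing by [0]. *)
pose M : R := `|v| + `|w| + 1; have M0 : 0 < M by rewrite ltr_wpDl ?addr_ge0.
pose s := r / M; have s0 : 0 < s by rewrite divr_gt0.
have box v' w' x y : `|v'| + `|w'| + 1 = M -> 0 <= x <= s -> 0 <= y <= s ->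
    (ball a r' `&` O) (a + x *: v' + y *: w').
  move=> ME /andP[x0 xs] /andP[y0 ys]; apply: rO.
  rewrite -ball_normE /ball_ /= -addrA opprD addNKr normrN.
  apply: (le_lt_trans (ler_normD _ _)); rewrite !normrZ !ger0_norm//.
  have : x * `|v'| + y * `|w'| <= s * (`|v'| + `|w'|).
    by rewrite mulrDr lerD// ler_wpM2r.
  move=> /le_lt_trans; apply; rewrite -ltr_pdivlMl// /s invf_div.
  by rewrite divfK ?gt_eqF// -ME ltrDl.
have [x [y [xs ys E1]]] := second_difference s0
  (fun x y xs ys => (box v w x y erefl xs ys).2) cf.
have ME : `|w| + `|v| + 1 = M by rewrite /M (addrC `|w|).
have [x' [y' [xs' ys' E2]]] := second_difference s0
  (fun x y xs ys => (box w v x y ME xs ys).2) cf.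
have wk (z : R) : 0 < z < s -> 0 <= z <= s by case/andP=> *; rewrite !ltW.
exists (a + x *: v + y *: w), (a + x' *: w + y' *: v); split.
- exact: (box v w x y erefl (wk _ xs) (wk _ ys)).1.
- exact: (box w v x' y' ME (wk _ xs') (wk _ ys')).1.
have sn0 : s != 0 by rewrite gt_eqF.
apply: (mulfI sn0); apply: (mulfI sn0); apply: etrans (esym E1) _; apply: etrans E2.
rewrite [a + s *: w + s *: v]addrAC; ring.
Qed.

Lemma schwarz_mx m n (f : V -> 'M[R]_(m, n)) (O : set V) (a v w : V) :
  open O -> O a -> Cinfty O f -> 'D_w ('D_v f) a = 'D_v ('D_w f) a.
Proof.
move=> oO Oa cf; apply/matrixP => i j.
have dE u b : O b -> 'D_u f b i j = 'D_u (fun x => f x i j) b.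
  by move=> Ob; rewrite derive_entry//; exact: Cinfty_differentiable cf Ob.
have ddE u u' : 'D_u ('D_u' f) a i j = 'D_u ('D_u' (fun x => f x i j)) a.
  rewrite derive_entry; last exact: Cinfty_differentiable (Cinfty_derive _ cf) Oa.
  by apply: (derive_on _ oO Oa) => b; exact: dE.
have cfij : Ck 2 O (fun x => f x i j) := Cinfty_entry oO i j cf 2.
have sE := schwarz v w oO Oa cfij.
exact: (etrans (ddE w v) (etrans sE (esym (ddE v w)))).
Qed.

Lemma derive0_near_cst (f : V -> R) (O : set V) (a : V) : open O -> O a ->
  (forall b, O b -> differentiable f b) -> (forall b v, O b -> 'D_v f b = 0) ->
  \forall b \near a, f b = f a.
Proof.
move=> oO Oa df Df0.
have /nbhs_ballP[r /= r0 rP] : \forall b \near a, O b by exact: open_nbhs_nbhs.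
apply/nbhs_ballP; exists r => // b ab /=.
have ball_seg x : 0 <= x <= 1 -> O (a + x *: (b - a)).
  move=> /andP[x0 x1]; apply: rP; move: ab; rewrite -!ball_normE /ball_ /=.
  rewrite opprD addNKr normrN normrZ ger0_norm// => ab.
  by rewrite (le_lt_trans _ ab)// distrC ler_piMl.
have [|x xs] := @mean_value_line f a (b - a) 1 ltr01.
  by move=> x /ball_seg; exact: df.
rewrite Df0 ?mulr0; last by apply: ball_seg; case/andP: xs => *; rewrite !ltW.
by rewrite scale1r [a + _]addrC subrK => /eqP; rewrite subr_eq0 => /eqP.
Qed.

End MeanValue.

(** * Inner product, orthogonal projection and Jacobian matrices *)

Section DotProduct.
Context {R : realType} {k : nat}.
Implicit Types (u v w : 'rV[R]_k) (S : set 'rV[R]_k).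

Lemma dotvE u v : dotv u v = (u *m v^T) 0 0.
Proof. by rewrite mxE; apply: eq_bigr => i _; rewrite mxE. Qed.

Lemma dotvC u v : dotv u v = dotv v u.
Proof. by apply: eq_bigr => i _; rewrite mulrC. Qed.

Lemma dotvDl u v w : dotv (u + v) w = dotv u w + dotv v w.
Proof. by rewrite !dotvE mulmxDl mxE. Qed.

Lemma dotvDr u v w : dotv w (u + v) = dotv w u + dotv w v.
Proof. by rewrite dotvC dotvDl !(dotvC w). Qed.

Lemma dotvZl c u v : dotv (c *: u) v = c * dotv u v.
Proof. by rewrite !dotvE -scalemxAl mxE. Qed.

Lemma dotvZr c u v : dotv v (c *: u) = c * dotv v u.
Proof. by rewrite dotvC dotvZl dotvC. Qed.

Lemma dotvNl u v : dotv (- u) v = - dotv u v.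
Proof. by rewrite -scaleN1r dotvZl mulN1r. Qed.

Lemma dotvNr u v : dotv v (- u) = - dotv v u.
Proof. by rewrite dotvC dotvNl dotvC. Qed.

Lemma dotvBl u v w : dotv (u - v) w = dotv u w - dotv v w.
Proof. by rewrite dotvDl dotvNl. Qed.

Lemma dotvBr u v w : dotv w (u - v) = dotv w u - dotv w v.
Proof. by rewrite dotvDr dotvNr. Qed.

Lemma dot0v u : dotv 0 u = 0.
Proof. by rewrite -(scale0r 0) dotvZl mul0r. Qed.

Lemma dotv0 u : dotv u 0 = 0.
Proof. by rewrite dotvC dot0v. Qed.

Lemma dotv_eq0 u : dotv u u = 0 -> u = 0.
Proof.
move=> /eqP; rewrite psumr_eq0 => [/allP u0|i _]; last by rewrite -expr2 sqr_ge0.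
apply/rowP => i; have := u0 i (mem_index_enum i).
by rewrite -expr2 sqrf_eq0 mxE => /eqP.
Qed.

Lemma dotv_neq0 u : u != 0 -> dotv u u != 0.
Proof. by apply: contra_neq; exact: dotv_eq0. Qed.

Lemma dotv_ext u v : (forall w, dotv w u = dotv w v) -> u = v.
Proof.
by move=> uv; apply/eqP; rewrite -subr_eq0; apply/eqP/dotv_eq0; rewrite dotvBr uv subrr.
Qed.

(** The orthogonal projection is unique: the difference of two candidates lies in [S]
    and is orthogonal to [S]. *)
Lemma oprojE S y z : (forall a b, S a -> S b -> S (a - b)) ->
  S z -> (forall s, S s -> dotv (y - z) s = 0) -> oproj S y = z.
Proof.
move=> SB Sz yz; rewrite /oproj; apply: xget_unique => // z' [Sz' yz'].
apply/eqP; rewrite -subr_eq0; apply/eqP/dotv_eq0.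
have E : z' - z = (y - z) - (y - z') by rewrite opprB [RHS]addrC subrKA.
by rewrite {1}E dotvBl yz ?yz' ?subrr//; exact: SB.
Qed.

End DotProduct.

Lemma dotv_mull {R : realType} m k (x : 'rV[R]_m) (A : 'M[R]_(m, k)) (u : 'rV[R]_k) :
  dotv (x *m A) u = dotv x (u *m A^T).
Proof. by rewrite !dotvE trmx_mul trmxK mulmxA. Qed.

(** Cancellation behind [sff_minus_metric]. There [X = dh v], [Y = dh y'] and
    [K = dF v] are tangent to [h], [T] and [T'] are values of sections of [N],
    [D = d xi v], [c = 2 phi / |F|^2], [b = <beta_bar, xi>] and
    [a = <alpha_h (v, y'), xi>]. *)
Lemma umbilic_identity {R : realType} k (X Y K D T T' : 'rV[R]_k) (c b a : R) :
  dotv Y T = 0 -> dotv X T' = 0 -> dotv K T' = 0 ->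
  dotv T' D = 0 -> dotv Y D = - a ->
  - dotv (Y - c *: T') (D + (c * b) *: (K + T)) -
    dotv (X - c *: K - c *: T) (Y - c *: T') * b = a - b * dotv X Y.
Proof.
move=> YT XT' KT' T'D YD.
rewrite !(dotvDl, dotvDr, dotvNl, dotvNr, dotvZl, dotvZr) YT XT' T'D YD.
rewrite (dotvC T' K) KT' (dotvC T Y) YT (dotvC T' T) (dotvC K Y); ring.
Qed.

Lemma dotv_add3 {R : realType} k (a b c y : 'rV[R]_k) r :
  dotv a y = r -> dotv y b = 0 -> dotv y c = 0 -> dotv (a + b + c) y = r.
Proof. by move=> ay yb yc; rewrite !dotvDl ay (dotvC b) yb (dotvC c) yc !addr0. Qed.

Section RowSpaceProjection.
Context {R : realType} {m k : nat}.
Implicit Types (A : 'M[R]_(m, k)) (y : 'rV[R]_k).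

(** If [x A A^T = 0] then [|x A|^2 = 0]. This gives an explicit and smooth formula for
    the projection onto a moving tangent space. *)
Lemma gram_unit A : (A *m A^T \in unitmx) = row_free A.
Proof.
apply/idP/idP => [u|fA].
  by apply/row_freeP; exists (A^T *m invmx (A *m A^T)); rewrite mulmxA mulmxV.
rewrite -row_free_unit -kermx_eq0; apply/eqP/row_matrixP => i.
set x := row i _; have xA : x *m (A *m A^T) = 0.
  by apply/sub_kermxP; exact: row_sub.
rewrite row0; apply: (row_free_inj fA); rewrite mul0mx; apply: dotv_eq0.
by rewrite dotv_mull -mulmxA xA dotv0.
Qed.

(** Orthogonal projection onto the row space of a matrix with free rows. *)
Definition rowproj A y := y *m A^T *m invmx (A *m A^T) *m A.

Lemma rowproj_sub A y : exists x : 'rV[R]_m, rowproj A y = x *m A.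
Proof. by exists (y *m A^T *m invmx (A *m A^T)). Qed.

Lemma rowproj_orth A y (x : 'rV[R]_m) : row_free A -> dotv (x *m A) (y - rowproj A y) = 0.
Proof.
rewrite -gram_unit => uA; rewrite dotv_mull mulmxBl -!mulmxA mulVmx// mulmx1.
by rewrite subrr dotv0.
Qed.

Lemma rowproj_orthl A y : row_free A -> (forall x : 'rV[R]_m, dotv (x *m A) y = 0) ->
  rowproj A y = 0.
Proof.
move=> fA yA; rewrite /rowproj (_ : y *m A^T = 0) ?mul0mx//.
by apply: dotv_ext => w; rewrite dotv0 -dotv_mull.
Qed.

Lemma row_free_injective A : injective (fun x : 'rV[R]_m => x *m A) -> row_free A.
Proof.
move=> iA; rewrite -kermx_eq0; apply/eqP/row_matrixP => i; apply: iA.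
by rewrite row0 mul0mx; apply/sub_kermxP; exact: row_sub.
Qed.

End RowSpaceProjection.

(** Equality of the ranks of [A] and [B] forces equality of their row spaces. *)
Lemma row_space_full {R : fieldType} m k (A B : 'M[R]_(m, k)) :
  row_free B -> (forall x : 'rV[R]_m, exists y : 'rV[R]_m, x *m B = y *m A) ->
  forall y : 'rV[R]_m, exists x : 'rV[R]_m, y *m A = x *m B.
Proof.
move=> fB BA y; suff /submxP[D AE] : (A <= B)%MS.
  by exists (y *m D); rewrite -mulmxA -AE.
have sBA : (B <= A)%MS.
  apply/row_subP => i; have [z zE] := BA (delta_mx 0 i).
  by rewrite rowE zE submxMl.
rewrite -(geq_leqif (mxrank_leqif_sup sBA)) (eqP fB) rank_leq_row//.
Qed.

Section DerivativeRules.
Context {R : realType} {V : normedModType R}.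

Lemma derive_scale m n (c : V -> R) (f : V -> 'M[R]_(m, n)) a v :
  differentiable c a -> differentiable f a ->
  'D_v (fun x => c x *: f x) a = 'D_v c a *: f a + c a *: 'D_v f a.
Proof.
move=> dc df; have dE i j : differentiable (fun x => c x * f x i j) a.
  by apply: differentiableM => //; exact: differentiable_entry.
have dcf : differentiable (fun x => c x *: f x) a.
  apply: differentiable_mxP => i j.
  by rewrite (_ : (fun x => _) = (fun x => c x * f x i j))//; apply/funext => x; rewrite mxE.
apply/matrixP => i j; rewrite derive_entry// !mxE derive_entry//.
rewrite (_ : (fun x => _) = (c * (fun x => f x i j))); last first.
  by apply/funext => x; rewrite mxE.
rewrite deriveM.
- by rewrite addrC; congr (_ + _); exact: mulrC.
- exact: diff_derivable.
- by apply: diff_derivable; exact: differentiable_entry.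
Qed.

Lemma derive_dotv k (f g : V -> 'rV[R]_k) a v :
  differentiable f a -> differentiable g a ->
  'D_v (fun x => dotv (f x) (g x)) a =
  dotv ('D_v f a) (g a) + dotv (f a) ('D_v g a).
Proof.
move=> df dg; have dM i : differentiable (fun x => f x 0 i * g x 0 i) a.
  by apply: differentiableM; exact: differentiable_entry.
rewrite (_ : (fun x => _) = \sum_i (fun x => f x 0 i * g x 0 i)); last first.
  by apply/funext => x; rewrite fct_sumE.
rewrite derive_sum; last by move=> i; exact: diff_derivable.
rewrite -big_split; apply: eq_bigr => i _ /=.
rewrite deriveM; try by apply: diff_derivable; exact: differentiable_entry.
rewrite !derive_entry// addrC; congr (_ + _); exact: mulrC.
Qed.

End DerivativeRules.

Lemma jacobian_entry {R : realType} m k (f : 'rV[R]_m -> 'rV[R]_k) a i j :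
  differentiable f a -> jacobian f a i j = 'D_(delta_mx 0 i) f a 0 j.
Proof. by move=> df; rewrite deriveEjacobian// -rowE [RHS]mxE. Qed.

Lemma Cinfty_jacobian {R : realType} m k (O : set 'rV[R]_m)
    (f : 'rV[R]_m -> 'rV[R]_k) :
  open O -> Cinfty O f -> Cinfty O (jacobian f).
Proof.
move=> oO cf; apply: Cinfty_mx => // i j.
have cD := Cinfty_entry oO 0 j (Cinfty_derive (delta_mx 0 i) cf).
apply: (@Cinfty_ext _ _ _ oO R _ _ _ cD) => a Oa.
by rewrite jacobian_entry//; exact: Cinfty_differentiable cf Oa.
Qed.

Lemma Cinfty_rowproj {R : realType} {V : normedModType R} (O : set V) m k
    (A : V -> 'M[R]_(m, k)) (y : V -> 'rV[R]_k) :
  open O -> (forall a, O a -> row_free (A a)) -> Cinfty O A -> Cinfty O y ->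
  Cinfty O (fun a => rowproj (A a) (y a)).
Proof.
move=> oO fA cA cy; have cT := Cinfty_trmx oO cA.
apply: Cinfty_mulmx => //; apply: Cinfty_mulmx => //; first exact: Cinfty_mulmx.
apply: Cinfty_invmx => //; last exact: Cinfty_mulmx.
by move=> a /fA; rewrite gram_unit.
Qed.

(** * Change of charts, local constancy and local connectedness *)

Section Charts.
Context {R : realType} {V : normedModType R}.

Lemma open_param (T : topologicalType) (c : chart V T) (U : set T) :
  open U -> open [set a | cod c a /\ U (param c a)].
Proof.
move=> oU; rewrite openE => a [ca Ua]; apply: filterI.
  exact: open_nbhs_nbhs (conj (cod_open c) ca).
exact: param_continuous ca _ (open_nbhs_nbhs (conj oU Ua)).
Qed.

Lemma nbhs_coord (T : topologicalType) (c : chart V T) (x : T) (P : set V) :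
  dom c x -> nbhs (coord c x) P -> \forall y \near x, dom c y /\ P (coord c y).
Proof.
move=> dx nP; apply: filterI; first exact: open_nbhs_nbhs (conj (dom_open c) dx).
exact: Defs.coord_continuous dx _ nP.
Qed.

(** This suffices to compare first derivatives in different charts, and it passes to
    products ([prod_transitions]). *)
Definition differentiable_transitions (M : charted V) : Prop :=
  forall (x y : M) a, cod (chart_at x) a -> dom (chart_at y) (param (chart_at x) a) ->
    differentiable (coord (chart_at y) \o param (chart_at x)) a.

Lemma smooth_manifold_transitions (M : charted V) :
  smooth_manifold M -> differentiable_transitions M.
Proof.
by move=> [_ _ sM] x y a ca da; apply: Cinfty_differentiable (sM x y) _.
Qed.

Variable M : charted V.
Hypothesis dM : differentiable_transitions M.

(** The differential at [a] of the change of coordinates to the preferred chart of the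
    point with coordinates [a]. *)
Definition transition (x : M) (a v : V) : V :=
  'D_v (coord (chart_at (param (chart_at x) a)) \o param (chart_at x)) a.

(** [dmap] is computed in a chart that moves with the point. As [transition x a] is
    bijective, linear conditions on first derivatives, such as tangency or
    orthogonality, may nevertheless be read in a single chart near a given point. *)
Lemma chart_change (W : normedModType R) (F : M -> W) (x : M) a :
  cod (chart_at x) a ->
  differentiable (F \o param (chart_at (param (chart_at x) a)))
    (coord (chart_at (param (chart_at x) a)) (param (chart_at x) a)) ->
  differentiable (F \o param (chart_at x)) a /\
  forall v, 'D_v (F \o param (chart_at x)) a =
            dmap F (param (chart_at x) a) (transition x a v).
Proof.
move=> ca; set y := param (chart_at x) a => dF.
pose O := [set b | cod (chart_at x) b /\ dom (chart_at y) (param (chart_at x) b)].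
have oO : open O by apply: open_param; exact: dom_open.
have Oa : O a by split=> //; exact: mem_chart_at.
have E b : O b -> ((F \o param (chart_at y)) \o (coord (chart_at y) \o param (chart_at x))) b
   = (F \o param (chart_at x)) b by move=> [cb db] /=; rewrite coordK.
have dT : differentiable (coord (chart_at y) \o param (chart_at x)) a.
  by apply: dM => //; exact: mem_chart_at.
split; first by apply: (differentiable_on oO Oa E); exact: differentiable_comp.
by move=> v; rewrite -(derive_on v oO Oa E) (derive_comp v dT dF).
Qed.

Lemma transition_inj (x : M) a v : cod (chart_at x) a ->
  transition x a v = 0 -> v = 0.
Proof.
move=> ca; set y := param (chart_at x) a => Tv0.
pose O := [set b | cod (chart_at x) b /\ dom (chart_at y) (param (chart_at x) b)].
have oO : open O by apply: open_param; exact: dom_open.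
have Oa : O a by split=> //; exact: mem_chart_at.
have E b : O b -> ((coord (chart_at x) \o param (chart_at y)) \o
    (coord (chart_at y) \o param (chart_at x))) b = id b.
  by move=> [cb db] /=; rewrite coordK// paramK.
have dT : differentiable (coord (chart_at y) \o param (chart_at x)) a.
  by apply: dM => //; exact: mem_chart_at.
have dS : differentiable (coord (chart_at x) \o param (chart_at y))
    ((coord (chart_at y) \o param (chart_at x)) a).
  apply: dM; first by apply: coord_cod; exact: mem_chart_at.
  by rewrite /= coordK; [exact: param_dom|exact: mem_chart_at].
have := derive_on v oO Oa E; rewrite derive_id (derive_comp v dT dS) => <-.
by rewrite -[X in 'D_X _ _]/(transition x a v) Tv0 derive0.
Qed.

Lemma transition_surj (x : M) a v : cod (chart_at x) a ->
  exists w, transition x a w = v.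
Proof.
move=> ca; set y := param (chart_at x) a.
have dy : dom (chart_at y) y by exact: mem_chart_at.
pose b := coord (chart_at y) y.
pose O := [set b | cod (chart_at y) b /\ dom (chart_at x) (param (chart_at y) b)].
have oO : open O by apply: open_param; exact: dom_open.
have yE : param (chart_at y) b = y by rewrite /b coordK.
have Ob : O b by split; [exact: coord_cod|rewrite yE; exact: param_dom].
have E c : O c -> ((coord (chart_at y) \o param (chart_at x)) \o
    (coord (chart_at x) \o param (chart_at y))) c = id c.
  by move=> [cc dc] /=; rewrite coordK// paramK.
have bE : (coord (chart_at x) \o param (chart_at y)) b = a.
  by rewrite /= yE paramK.
have dS : differentiable (coord (chart_at x) \o param (chart_at y)) b.
  by apply: dM; [case: Ob|case: Ob].
have dT : differentiable (coord (chart_at y) \o param (chart_at x))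
    ((coord (chart_at x) \o param (chart_at y)) b).
  by rewrite bE; apply: dM.
exists ('D_v (coord (chart_at x) \o param (chart_at y)) b).
have := derive_on v oO Ob E; rewrite derive_id (derive_comp v dS dT) => {2}<-.
by rewrite bE.
Qed.

(** The fibres of a locally constant map are open and closed. *)
Lemma near_cst_connected (T : topologicalType) (U : Type) (C : set T) (F : T -> U) :
  connected C -> (forall x, C x -> \forall y \near x, F y = F x) ->
  forall x y, C x -> C y -> F x = F y.
Proof.
move=> cC nF x y Cx Cy.
have near_fiber z : C z -> \forall w \near z, F w = F z by exact: nF.
suff CE : C `&` [set z | F z = F y] = C by move: Cx; rewrite -CE => -[].
apply: cC; first by exists y.
- exists ([set z | F z = F y]°); first exact: open_interior.
  apply/seteqP; split=> z [Cz Fz]; split=> //; last exact: interior_subset Fz.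
  by rewrite /interior /= -Fz; exact: nF.
(* A point where [F] differs from [F y] has a neighbourhood of such points. *)
- exists (~` [set z | F z <> F y]°).
    by rewrite closedC; exact: open_interior.
  apply/seteqP; split=> z [Cz Fz]; split=> //.
    by move=> /interior_subset; exact.
  apply: contrapT => Fzy; apply: Fz; apply: filterS (nF z Cz) => w /=.
  by move=> ->.
Qed.

Lemma dmap0_cst (F : M -> R) (C : set M) : open C -> connected C ->
  (forall y, C y -> differentiable (F \o param (chart_at y)) (coord (chart_at y) y)) ->
  (forall y v, C y -> dmap F y v = 0) ->
  forall x y, C x -> C y -> F x = F y.
Proof.
move=> oC cC dF F0; apply: near_cst_connected cC _ => x Cx.
have dx : dom (chart_at x) x by exact: mem_chart_at.
pose O := [set a | cod (chart_at x) a /\ C (param (chart_at x) a)].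
have oO : open O by exact: open_param.
have Ox : O (coord (chart_at x) x) by split; [exact: coord_cod|rewrite coordK].
have dFO b : O b -> differentiable (F \o param (chart_at x)) b.
  by move=> [cb Cb]; have [] := chart_change cb (dF _ Cb).
have F0O b v : O b -> 'D_v (F \o param (chart_at x)) b = 0.
  by move=> [cb Cb]; have [_ ->] := chart_change cb (dF _ Cb); exact: F0.
apply: filterS (nbhs_coord dx (derive0_near_cst oO Ox dFO F0O)) => y [dy] /=.
by rewrite !coordK.
Qed.

(** Manifolds are locally connected: a chart joins nearby points by the image of a
    segment. *)
Lemma open_component (A : set M) x : open A -> open (connected_component A x).
Proof.
move=> oA; rewrite openE => y yx.
have Ay : A y by exact: connected_component_sub yx.
have -> : connected_component A x = connected_component A y.
  exact: same_connected_component.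
have dy : dom (chart_at y) y by exact: mem_chart_at.
pose a := coord (chart_at y) y.
pose O := [set a | cod (chart_at y) a /\ A (param (chart_at y) a)].
have oO : open O by exact: open_param.
have Oa : O a by split; [exact: coord_cod|rewrite /a coordK].
have /nbhs_ballP[r /= r0 rP] : \forall b \near a, O b by exact: open_nbhs_nbhs.
apply: filterS (nbhs_coord dy (nbhsx_ballx a r r0)) => z [dz az] /=.
pose g (s : R) := param (chart_at y) (a + s *: (coord (chart_at y) z - a)).
have gO s : s \in `[0, 1] -> O (a + s *: (coord (chart_at y) z - a)).
  rewrite in_itv /= => /andP[s0 s1]; apply: rP; move: az; rewrite -!ball_normE /ball_ /=.
  rewrite opprD addNKr normrN normrZ ger0_norm// => az.
  by rewrite (le_lt_trans _ az)// distrC ler_piMl.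
apply: (@connected_component_max _ A (g @` `[0, 1])).
- by exists 0; [rewrite /= in_itv /= lexx ler01|rewrite /g scale0r addr0 coordK].
- by move=> _ [s /gO[_ ?] <-].
- apply: connected_continuous_connected; first exact: segment_connected.
  apply: continuous_in_subspaceT => s; rewrite inE => /gO[cs _].
  apply: (@continuous_comp _ _ _ (fun s : R => a + s *: (coord (chart_at y) z - a))).
    exact/differentiable_continuous/differentiable_line.
  exact: param_continuous.
- exists 1; first by rewrite /= in_itv /= lexx ler01.
  by rewrite /g scale1r addrC subrK coordK.
Qed.

End Charts.

(** * Reflections along a vector field *)

Section Reflection.
Context {R : realType} {k : nat}.
Implicit Types F x y : 'rV[R]_k.

(** The reflection in the hyperplane orthogonal to [F]. *)
Definition refl F x := x - (2 * (dotv F F)^-1 * dotv F x) *: F.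

Lemma refl_dot F x y : dotv (refl F x) y = dotv x (refl F y).
Proof.
by rewrite /refl dotvBl dotvBr dotvZl dotvZr (dotvC x F); congr (_ - _); ring.
Qed.

Lemma reflK F x : F != 0 -> refl F (refl F x) = x.
Proof.
move=> /dotv_neq0 F0; rewrite {1}/refl /refl dotvBr dotvZr.
rewrite -addrA -opprD -scalerDl [X in X *: F](_ : _ = 0) ?scale0r ?subr0//.
by field.
Qed.

Lemma refl_isometry F x y : F != 0 -> dotv (refl F x) (refl F y) = dotv x y.
Proof. by move=> F0; rewrite refl_dot reflK. Qed.

Lemma refl0 F : refl F 0 = 0.
Proof. by rewrite /refl dotv0 mulr0 scale0r subr0. Qed.

End Reflection.

Section ReflectionCalculus.
Context {R : realType} {V : normedModType R} {k : nat}.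
Variables (F : V -> 'rV[R]_k) (a v : V).
Hypotheses (dF : differentiable F a) (F0 : F a != 0).

Lemma differentiable_dotv (f g : V -> 'rV[R]_k) :
  differentiable f a -> differentiable g a ->
  differentiable (fun x => dotv (f x) (g x)) a.
Proof.
move=> df dg; rewrite (_ : (fun x => _) = \sum_i (fun x => f x 0 i * g x 0 i)).
  by apply: differentiable_sum => i; apply: differentiableM; exact: differentiable_entry.
by apply/funext => x; rewrite fct_sumE.
Qed.

Lemma differentiable_invnorm : differentiable (fun x => (dotv (F x) (F x))^-1) a.
Proof. by apply: differentiableV; [exact: differentiable_dotv|exact: dotv_neq0]. Qed.

Lemma derive_invnorm : 'D_v (fun x => (dotv (F x) (F x))^-1) a =
  - 2 * (dotv (F a) (F a))^-1 ^+ 2 * dotv (F a) ('D_v F a).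
Proof.
have dd := differentiable_dotv dF dF.
rewrite [LHS](@deriveV _ _ (fun x => dotv (F x) (F x))).
- rewrite derive_dotv// (dotvC ('D_v F a)) exprVn -[_ *: _]/(_ * _); ring.
- exact: dotv_neq0.
- exact: diff_derivable.
Qed.

Lemma differentiable_scale (c : V -> R) (f : V -> 'rV[R]_k) :
  differentiable c a -> differentiable f a -> differentiable (fun x => c x *: f x) a.
Proof.
move=> dc df; apply: differentiable_mxP => i j.
rewrite (_ : (fun x => _) = (fun x => c x * f x i j)); last first.
  by apply/funext => x; rewrite mxE.
by apply: differentiableM => //; exact: differentiable_entry.
Qed.

(** The term with [<dF, xi>] drops out, and the derivative of [|F|^-2] is what
    completes the multiple of [dF] to its reflection. *)
Lemma derive_refl (xi : V -> 'rV[R]_k) : differentiable xi a ->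
  dotv ('D_v F a) (xi a) = 0 ->
  'D_v (fun x => refl (F x) (xi x)) a =
  refl (F a) ('D_v xi a - (2 * (dotv (F a) (F a))^-1 * dotv (F a) (xi a)) *: 'D_v F a).
Proof.
move=> dxi Fxi; have dn := differentiable_invnorm; have dd := differentiable_dotv dF dxi.
pose c x := (2 * (dotv (F x) (F x))^-1) * dotv (F x) (xi x).
have d2n : differentiable (fun x => 2 * (dotv (F x) (F x))^-1) a.
  by apply: differentiableM.
have dc : differentiable c a by apply: differentiableM.
have Dc : 'D_v c a = 2 * (dotv (F a) (F a))^-1 * dotv (F a) ('D_v xi a) +
    dotv (F a) (xi a) * (2 * 'D_v (fun x => (dotv (F x) (F x))^-1) a).
  rewrite [LHS](@deriveM _ _ (fun x => 2 * (dotv (F x) (F x))^-1) (fun x => dotv (F x) (xi x)));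
    [|exact: diff_derivable|exact: diff_derivable].
  rewrite derive_dotv// Fxi add0r; congr (_ + _ * _).
  rewrite [LHS](@deriveM _ _ (fun=> 2) (fun x => (dotv (F x) (F x))^-1));
    [|exact: derivable_cst|exact: diff_derivable].
  by rewrite derive_cst scaler0 addr0.
rewrite [LHS](@deriveB _ _ _ xi (fun x => c x *: F x)); [|exact: diff_derivable|]; last first.
  by apply: diff_derivable; exact: differentiable_scale.
rewrite derive_scale// Dc derive_invnorm /refl /c dotvBr dotvZr.
set nu := (dotv (F a) (F a))^-1.
by apply/rowP => i; rewrite !mxE; ring.
Qed.

(** As [phi] is a potential of the form [<F, dH>], the coefficient of [F] in the
    derivative is the one in the reflection of [dH - c dF], where [c = 2 phi / |F|^2]. *)
Lemma derive_ribaucour (H : V -> 'rV[R]_k) (phi : V -> R) :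
  differentiable H a -> differentiable phi a ->
  dotv (F a) ('D_v H a) = 'D_v phi a ->
  'D_v (fun x => H x - (2 * phi x * (dotv (F x) (F x))^-1) *: F x) a =
  refl (F a) ('D_v H a - (2 * phi a * (dotv (F a) (F a))^-1) *: 'D_v F a).
Proof.
move=> dH dphi FH; have dn := differentiable_invnorm.
pose c x := (2 * phi x) * (dotv (F x) (F x))^-1.
have d2p : differentiable (fun x => 2 * phi x) a by apply: differentiableM.
have dc : differentiable c a by apply: differentiableM.
have Dc : 'D_v c a = (2 * phi a) * 'D_v (fun x => (dotv (F x) (F x))^-1) a +
    (dotv (F a) (F a))^-1 * (2 * 'D_v phi a).
  rewrite [LHS](@deriveM _ _ (fun x => 2 * phi x) (fun x => (dotv (F x) (F x))^-1));
    [|exact: diff_derivable|exact: diff_derivable].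
  congr (_ + _ * _).
  rewrite [LHS](@deriveM _ _ (fun=> 2) phi); [|exact: derivable_cst|exact: diff_derivable].
  by rewrite derive_cst scaler0 addr0.
rewrite [LHS](@deriveB _ _ _ H (fun x => c x *: F x)); [|exact: diff_derivable|]; last first.
  by apply: diff_derivable; exact: differentiable_scale.
rewrite derive_scale// Dc derive_invnorm /refl /c dotvBr dotvZr FH.
set nu := (dotv (F a) (F a))^-1.
by apply/rowP => i; rewrite !mxE; ring.
Qed.

End ReflectionCalculus.

Section DirectionalDerivatives.
Context {R : realType} {V : normedModType R} {k : nat}.

Lemma derive_orthogonal (f g : V -> 'rV[R]_k) (O : set V) a v : open O -> O a ->
  (forall b, O b -> dotv (f b) (g b) = 0) ->
  differentiable f a -> differentiable g a ->
  dotv ('D_v f a) (g a) = - dotv (f a) ('D_v g a).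
Proof.
move=> oO Oa fg df dg; apply/eqP; rewrite -addr_eq0 -derive_dotv//.
by rewrite (derive_on (g := cst 0) v oO Oa fg) derive_cst.
Qed.

Lemma derive_partial (V' W : normedModType R) (f : V * V' -> W) a t v w :
  differentiable f (a, t) ->
  'D_(v, w) f (a, t) = 'D_v (fun b => f (b, t)) a + 'D_w (fun t' => f (a, t')) t.
Proof.
move=> df; have d1 : differentiable (fun b : V => (b, t)) a.
  by apply: differentiable_pair.
have d2 : differentiable (fun t' : V' => (a, t')) t by apply: differentiable_pair.
have e1 : 'D_v (fun b : V => (b, t)) a = (v, 0).
  by rewrite deriveE// diff_pair// !diff_val.
have e2 : 'D_w (fun t' : V' => (a, t')) t = (0, w).
  by rewrite deriveE// diff_pair// !diff_val.
rewrite (derive_comp (f := fun b : V => (b, t)) v d1 df).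
rewrite (derive_comp (f := fun t' : V' => (a, t')) w d2 df) e1 e2.
rewrite !deriveE// -linearD/=; congr ('d f _ _).
by apply/pair_equal_spec; rewrite /= addr0 add0r.
Qed.

End DirectionalDerivatives.

(** * Tangent and normal spaces of an immersion *)

Section Projections.
Context {R : realType} {k : nat}.
Implicit Types (S : set 'rV[R]_k) (y : 'rV[R]_k).

Lemma oproj_compl m (B : 'M[R]_(m, k)) S y : row_free B ->
  (forall z, S z <-> forall v : 'rV[R]_m, dotv (v *m B) z = 0) ->
  oproj S y = y - rowproj B y.
Proof.
move=> fB SE; apply: oprojE.
- by move=> a b /SE Sa /SE Sb; apply/SE => v; rewrite dotvBr Sa Sb subrr.
- by apply/SE => v; exact: rowproj_orth.
- by move=> z /SE Sz; rewrite opprB addrC subrK; have [x ->] := rowproj_sub B y.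
Qed.

Lemma oproj_compl2 m s (B : 'M[R]_(m, k)) (T : 'M[R]_(s, k)) S y :
  row_free B -> row_free T ->
  (forall (v : 'rV[R]_m) (w : 'rV[R]_s), dotv (v *m B) (w *m T) = 0) ->
  (forall z, S z <-> (forall v : 'rV[R]_m, dotv (v *m B) z = 0) /\
                     (forall w : 'rV[R]_s, dotv (w *m T) z = 0)) ->
  oproj S y = y - rowproj B y - rowproj T y.
Proof.
move=> fB fT BT SE; apply: oprojE.
- by move=> a b /SE[Sa Ta] /SE[Sb Tb]; apply/SE; split=> v;
    rewrite dotvBr ?Sa ?Sb ?Ta ?Tb subrr.
- apply/SE; split=> v; first by rewrite dotvBr rowproj_orth// sub0r;
    have [x ->] := rowproj_sub T y; rewrite BT oppr0.
  rewrite addrAC dotvBr rowproj_orth// sub0r.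
  by have [x ->] := rowproj_sub B y; rewrite dotvC BT oppr0.
- move=> z /SE[Sz Tz]; rewrite -addrA -opprD opprB addrC subrK dotvDl.
  by have [x ->] := rowproj_sub B y; have [x' ->] := rowproj_sub T y; rewrite Sz Tz addr0.
Qed.

Lemma row_space_eq m (B : 'M[R]_(m, k)) (p q : 'rV[R]_m) :
  (forall v : 'rV[R]_m, dotv (v *m B) (p *m B) = dotv (v *m B) (q *m B)) ->
  p *m B = q *m B.
Proof.
move=> pq; apply/eqP; rewrite -subr_eq0; apply/eqP/dotv_eq0.
by rewrite -{1}mulmxBl dotvBr pq subrr.
Qed.

End Projections.

Section Smooth.
Context {R : realType} {V : normedModType R} (M : charted V).

Lemma smooth_onP (W : normedModType R) (F : M -> W) : smooth_on setT F <->
  forall x, Cinfty (cod (chart_at x)) (F \o param (chart_at x)).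
Proof.
split=> [sF x|sF x _]; first exact: Cinfty_sub (sF x I).
by apply: Cinfty_sub (sF x) => a [].
Qed.

Lemma smooth_differentiable (W : normedModType R) (F : M -> W) x a :
  smooth_on setT F -> cod (chart_at x) a ->
  differentiable (F \o param (chart_at x)) a.
Proof. by move=> /smooth_onP sF; exact: Cinfty_differentiable (sF x). Qed.

Lemma smooth_dmap (W : normedModType R) (F : M -> W) x :
  smooth_on setT F -> differentiable (F \o param (chart_at x)) (coord (chart_at x) x).
Proof.
by move=> sF; apply: smooth_differentiable => //; apply: coord_cod; exact: mem_chart_at.
Qed.

End Smooth.

Section Immersion.
Context {R : realType} {m k : nat} (L : charted 'rV[R]_m) (h : L -> 'rV[R]_k).
Hypotheses (dL : differentiable_transitions L) (hh : immersion_on h setT).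

(** Its rows are the coordinate tangent vectors, so that tangent spaces become row
    spaces. *)
Definition chart_jac (x : L) (a : 'rV[R]_m) := jacobian (h \o param (chart_at x)) a.
Definition tangent_mx (u : L) := chart_jac u (coord (chart_at u) u).

Let sh : smooth_on setT h. Proof. by case: hh. Qed.

Lemma chart_jacE x a v : cod (chart_at x) a ->
  'D_v (h \o param (chart_at x)) a = v *m chart_jac x a.
Proof. by move=> ca; rewrite deriveEjacobian//; exact: smooth_differentiable. Qed.

Lemma tangent_mxE u v : dmap h u v = v *m tangent_mx u.
Proof. by apply: chart_jacE; apply: coord_cod; exact: mem_chart_at. Qed.

Lemma tangent_mx_free u : row_free (tangent_mx u).
Proof.
apply: row_free_injective => v w vw; have [_ /(_ u I)] := hh; apply.
by rewrite !tangent_mxE.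
Qed.

Lemma chart_jac_transition x a v : cod (chart_at x) a ->
  v *m chart_jac x a = transition x a v *m tangent_mx (param (chart_at x) a).
Proof.
move=> ca; rewrite -chart_jacE// -tangent_mxE.
by have [_ ->] := chart_change dL ca (smooth_dmap _ sh).
Qed.

Lemma chart_jac_free x a : cod (chart_at x) a -> row_free (chart_jac x a).
Proof.
move=> ca; apply: row_free_injective => v w /eqP; rewrite -subr_eq0 -mulmxBl => /eqP vw.
apply/eqP; rewrite -subr_eq0; apply/eqP; apply: (transition_inj dL ca).
apply: (row_free_inj (tangent_mx_free (param (chart_at x) a))).
by rewrite mul0mx -(chart_jac_transition _ ca).
Qed.

Lemma Cinfty_chart_jac x : Cinfty (cod (chart_at x)) (chart_jac x).
Proof.
by apply: Cinfty_jacobian; [exact: cod_open|exact: (smooth_onP _).1].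
Qed.

Lemma normal_spaceE u y :
  normal_space h u y <-> forall v : 'rV[R]_m, dotv (v *m tangent_mx u) y = 0.
Proof. by split=> yn v; have := yn v; rewrite tangent_mxE. Qed.

(** The rows of [chart_jac x a] and of [tangent_mx] at the same point span the same
    space, although they refer to different charts. *)
Lemma normal_space_chart x a y : cod (chart_at x) a ->
  normal_space h (param (chart_at x) a) y <->
  forall v : 'rV[R]_m, dotv (v *m chart_jac x a) y = 0.
Proof.
move=> ca; split=> [/normal_spaceE yn v|yn]; first by rewrite (chart_jac_transition _ ca).
apply/normal_spaceE => v; have [w <-] := transition_surj dL v ca.
by rewrite -(chart_jac_transition _ ca).
Qed.

Lemma nprojE u y : nproj h u y = y - rowproj (tangent_mx u) y.
Proof. by apply: oproj_compl; [exact: tangent_mx_free|exact: normal_spaceE]. Qed.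

Lemma nproj_normal u y : normal_space h u (nproj h u y).
Proof. by apply/normal_spaceE => v; rewrite nprojE rowproj_orth//; exact: tangent_mx_free. Qed.

Lemma nproj_dot u y z : normal_space h u z -> dotv (nproj h u y) z = dotv y z.
Proof.
move=> /normal_spaceE nz; rewrite nprojE dotvBl; have [x ->] := rowproj_sub (tangent_mx u) y.
by rewrite nz subr0.
Qed.

Lemma nproj_id u y : normal_space h u y -> nproj h u y = y.
Proof.
move=> /normal_spaceE ny; rewrite nprojE rowproj_orthl ?subr0//.
exact: tangent_mx_free.
Qed.

Lemma tangentP u y : (forall z, normal_space h u z -> dotv y z = 0) ->
  exists x : 'rV[R]_m, y = x *m tangent_mx u.
Proof.
move=> yt; have [x xE] := rowproj_sub (tangent_mx u) y; exists x; rewrite -xE.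
apply/eqP; rewrite -subr_eq0 -nprojE; apply/eqP/dotv_eq0.
by rewrite nproj_dot ?yt//; exact: nproj_normal.
Qed.

Lemma smooth_nproj y : smooth_on setT (fun u => nproj h u y).
Proof.
apply/smooth_onP => x; have oO := cod_open (chart_at x).
have cP : Cinfty (cod (chart_at x)) (fun a => y - rowproj (chart_jac x a) y).
  apply: CinftyB => //; first exact: Cinfty_cst.
  apply: Cinfty_rowproj => //; first exact: chart_jac_free.
    exact: Cinfty_chart_jac.
  exact: Cinfty_cst.
apply: Cinfty_ext cP => // a ca /=; apply/esym/oproj_compl; first exact: chart_jac_free.
by move=> z; exact: normal_space_chart.
Qed.

End Immersion.

(** * The gradient as an ambient vector field *)

#[local] Opaque chart_jac tangent_mx transition.

Lemma prod_transitions {R : realType} {V W : normedModType R} (M : charted V) :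
  differentiable_transitions M -> differentiable_transitions (prod_charted W M).
Proof.
move=> dM x y a ca da; apply: differentiable_pair; last exact: differentiable_snd.
apply: (@differentiable_comp _ _ _ _ fst
  (coord (chart_at y.1) \o param (chart_at x.1))); first exact: differentiable_fst.
exact: dM.
Qed.

Section Gradient.
Context {R : realType} {m k : nat} (L : charted 'rV[R]_m) (h : L -> 'rV[R]_k).
Hypotheses (dL : differentiable_transitions L) (hh : immersion_on h setT).
Variable phi : L -> R.
Hypothesis sphi : smooth_on setT phi.

Definition chart_diff (x : L) (a : 'rV[R]_m) : 'rV[R]_m :=
  \row_i 'D_(delta_mx 0 i) (phi \o param (chart_at x)) a.

Lemma chart_diffE x a v : cod (chart_at x) a ->
  'D_v (phi \o param (chart_at x)) a = dotv v (chart_diff x a).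
Proof.
move=> ca; have dp := smooth_differentiable sphi ca.
rewrite deriveE// {1}[v]row_sum_delta linear_sum; apply: eq_bigr => i _.
by rewrite linearZ /= mxE deriveE.
Qed.

(** The Gram matrix of an immersion is invertible, so that the gradient exists and the
    choice in its definition is not a default value. *)
Lemma gradientP u v : metric h u (gradient h phi u) v = dmap phi u v.
Proof.
have cu : cod (chart_at u) (coord (chart_at u) u) by apply: coord_cod; exact: mem_chart_at.
suff: [set g | forall v, metric h u g v = dmap phi u v] (gradient h phi u) by exact.
apply: xgetPex; pose A := tangent_mx h u.
exists (chart_diff u (coord (chart_at u) u) *m invmx (A *m A^T)) => w.
rewrite /metric !tangent_mxE// dotvC dotv_mull -!mulmxA mulVmx ?mulmx1.
  exact/esym/chart_diffE.
by rewrite gram_unit; exact: tangent_mx_free.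
Qed.

(** The ambient vector [h_* grad phi]. Unlike [gradient], whose value is a coordinate
    vector in the preferred chart of each point, it does not depend on charts, and so
    it makes sense to call it smooth. *)
Definition grad_vec (u : L) := dmap h u (gradient h phi u).

Lemma grad_vec_dot u v : dotv (grad_vec u) (dmap h u v) = dmap phi u v.
Proof. exact: gradientP. Qed.

Lemma grad_vec_chart x a : cod (chart_at x) a ->
  grad_vec (param (chart_at x) a) =
  chart_diff x a *m invmx (chart_jac h x a *m (chart_jac h x a)^T) *m chart_jac h x a.
Proof.
move=> ca; have [w wE] := transition_surj dL (gradient h phi (param (chart_at x) a)) ca.
have gE : grad_vec (param (chart_at x) a) = w *m chart_jac h x a.
  by rewrite /grad_vec (tangent_mxE hh) -wE (chart_jac_transition dL hh w ca).
rewrite gE; apply: row_space_eq => v; rewrite -gE.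
have -> : dotv (v *m chart_jac h x a) (grad_vec (param (chart_at x) a)) =
          dotv v (chart_diff x a).
  rewrite (chart_jac_transition dL hh v ca).
  rewrite dotvC -(tangent_mxE hh).
  rewrite grad_vec_dot.
  have [_ <-] := chart_change dL ca (smooth_dmap _ sphi).
  exact: chart_diffE.
rewrite dotv_mull -mulmxA -[X in _ = dotv _ X]mulmxA mulVmx ?mulmx1//.
by rewrite gram_unit; exact: chart_jac_free.
Qed.

Lemma smooth_grad_vec : smooth_on setT grad_vec.
Proof.
apply/smooth_onP => x; have oO := cod_open (chart_at x).
have cJ : Cinfty (cod (chart_at x)) (chart_jac h x) by exact: Cinfty_chart_jac.
have cd : Cinfty (cod (chart_at x)) (chart_diff x).
  apply: Cinfty_mx => // i j.
  have cD := Cinfty_derive (delta_mx 0 j) ((smooth_onP _).1 sphi x).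
  by apply: (@Cinfty_ext _ _ _ oO R _ _ _ cD) => a _; rewrite mxE.
apply: (Cinfty_ext oO (fun a ca => esym (grad_vec_chart ca))).
apply: Cinfty_mulmx => //; apply: Cinfty_mulmx => //; apply: Cinfty_invmx => //.
  by move=> a ca; rewrite gram_unit; exact: chart_jac_free.
by apply: Cinfty_mulmx => //; exact: Cinfty_trmx.
Qed.

End Gradient.

(** * The tangency equation of a Ribaucour pair *)

Section RibaucourPair.
Context {R : realType} {m k : nat} (L : charted 'rV[R]_m) (h : L -> 'rV[R]_k).
Hypotheses (dL : differentiable_transitions L) (hh : immersion_on h setT).
Variables (phi : L -> R) (beta : L -> 'rV[R]_k).
Hypothesis pr : Rib_pairs h (phi, beta).

Let sh : smooth_on setT h. Proof. by case: hh. Qed.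
Let sphi : smooth_on setT phi. Proof. by case: pr. Qed.
Let sbeta : smooth_on setT beta. Proof. by case: pr => _ []. Qed.
Let nbeta u : normal_space h u (beta u). Proof. by case: pr => _ []. Qed.
Let sG : smooth_on setT (grad_vec h phi). Proof. exact: smooth_grad_vec. Qed.

Lemma cod_center (u : L) : cod (chart_at u) (coord (chart_at u) u).
Proof. by apply: coord_cod; exact: mem_chart_at. Qed.

Lemma param_center (u : L) : param (chart_at u) (coord (chart_at u) u) = u.
Proof. by apply: coordK; exact: mem_chart_at. Qed.

(** Differentiate [<dh w, xi> = 0]. *)
Lemma sff_normal_field (xi : L -> 'rV[R]_k) u v w : smooth_on setT xi ->
  (forall x, normal_space h x (xi x)) ->
  dotv (sff h u v w) (xi u) = - dotv (dmap h u w) (dmap xi u v).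
Proof.
move=> sxi nxi; rewrite (nproj_dot hh _ (nxi u)).
pose H := h \o param (chart_at u).
pose X := xi \o param (chart_at u); pose c := coord (chart_at u) u.
suff : dotv ('D_v ('D_w H) c) (X c) = - dotv ('D_w H c) ('D_v X c).
  by rewrite {1}/X /= param_center.
apply: (@derive_orthogonal _ _ _ ('D_w H) X _ _ v (cod_open (chart_at u)) (cod_center u)).
- move=> b cb; rewrite /H (chart_jacE hh w cb).
  exact: (normal_space_chart dL hh (xi (param (chart_at u) b)) cb).1 (nxi _) w.
- apply: Cinfty_differentiable (cod_center u); apply: Cinfty_derive.
  exact: (smooth_onP _).1.
- exact: smooth_dmap.
Qed.

(** Schwarz theorem in the preferred chart of [u]. *)
Lemma sff_sym u v w : sff h u v w = sff h u w v.
Proof.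
have E := schwarz_mx w v (cod_open (chart_at u)) (cod_center u) ((smooth_onP h).1 sh u).
exact: (congr1 (Defs.nproj h u) E).
Qed.

(** The defining equation of a pair, [alpha (grad phi, v) + nabla_v beta = 0], is the
    vanishing of the normal part of [d (h_* grad phi + beta)]: by symmetry of the
    second derivatives, the normal part of [d_v (h_* grad phi)] is
    [alpha (grad phi, v)]. The vector [z] is extended to the normal field [xi] by
    projection, to have a field whose products with tangent vectors vanish
    identically. *)
Lemma grad_beta_tangent u v z : normal_space h u z ->
  dotv (dmap (grad_vec h phi) u v + dmap beta u v) z = 0.
Proof.
move=> nz; pose xi x := Defs.nproj h x z.
have sxi : smooth_on setT xi by exact: smooth_nproj.
have nxi x : normal_space h x (xi x) by exact: nproj_normal.
have xiu : xi u = z by exact: nproj_id.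
set g := gradient h phi u.
have [_ _ Spair _] := pr.
have Seq : dotv (sff h u v g) z + dotv (nabla_perp h beta u v) z = 0.
  by rewrite (sff_sym u v g) -dotvDl [X in dotv X _]Spair dot0v.
have sE : dotv (sff h u v g) z = - dotv (dmap h u g) (dmap xi u v).
  by rewrite -[X in dotv _ X = _]xiu; exact: sff_normal_field.
have nE : dotv (nabla_perp h beta u v) z = dotv (dmap beta u v) z by exact: nproj_dot.
have {}Seq := etrans (f_equal2 (fun x y => x + y) (esym sE) (esym nE)) Seq.
rewrite dotvDl -[RHS]Seq; congr (_ + _); rewrite -xiu.
pose X := xi \o param (chart_at u); pose c := coord (chart_at u) u.
pose Y := grad_vec h phi \o param (chart_at u).
suff : dotv ('D_v Y c) (X c) = - dotv (Y c) ('D_v X c).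
  by rewrite {1}/X {2}/Y /= param_center.
apply: (@derive_orthogonal _ _ _ (grad_vec h phi \o param (chart_at u)) X _ _ v
  (cod_open (chart_at u)) (cod_center u)).
- move=> b cb; exact: nxi.
- exact: smooth_dmap.
- exact: smooth_dmap.
Qed.

End RibaucourPair.

(** * Maps on a product of coordinate spaces *)

Lemma Rib_FE {R : realType} {V : normedModType R} (L : charted V) k
    (h : L -> 'rV[R]_k) phi beta t u :
  Rib_F h phi beta t u = dmap h u (gradient h phi u) + beta u + t u.
Proof. by []. Qed.

Lemma open_Cinfty_neq0 {R : realType} {V : normedModType R} (O : set V) (g : V -> R) :
  open O -> Cinfty O g -> open [set b | O b /\ g b != 0].
Proof.
move=> oO cg; rewrite openE => b [Ob gb]; apply: filterI.
  exact: open_nbhs_nbhs (conj oO Ob).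
exact: cvgr_neq0 (Cinfty_continuous cg Ob) gb.
Qed.

Lemma Cinfty_refl {R : realType} {V : normedModType R} k (O : set V)
    (F y : V -> 'rV[R]_k) : open O -> (forall b, O b -> F b != 0) ->
  Cinfty O F -> Cinfty O y -> Cinfty O (fun b => refl (F b) (y b)).
Proof.
move=> oO F0 cF cy; apply: CinftyB => //; apply: CinftyZ => //.
apply: CinftyM => //; last exact: Cinfty_dotv.
apply: CinftyM => //; first exact: Cinfty_cst.
apply: CinftyV => //; last exact: Cinfty_dotv.
by move=> b /F0; exact: dotv_neq0.
Qed.

Lemma dmap_injectiveP {R : realType} {V W : normedModType R} (M : charted V)
    (f : M -> W) q :
  differentiable (f \o param (chart_at q)) (coord (chart_at q) q) ->
  injective (dmap f q) <-> forall v, dmap f q v = 0 -> v = 0.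
Proof.
move=> df; split=> [iD v|iD v w].
  rewrite -[X in _ = X](derive0 (f \o param (chart_at q)) (coord (chart_at q) q)).
  exact: iD.
move=> vw; apply/eqP; rewrite -subr_eq0; apply/eqP/iD.
have := derive_is_linear (- 1) w v df; rewrite !scaleN1r addrC => E.
apply: (etrans E); apply/eqP; rewrite addrC subr_eq0; exact/eqP.
Qed.

Section ProductJacobian.
Context {R : realType} {m s k : nat}.
Variables (g : 'rV[R]_m * 'rV[R]_s -> 'rV[R]_k) (b : 'rV[R]_m * 'rV[R]_s).

(** The differential of [g] in the standard basis of the product, identified with row
    vectors of length [m + s]. *)
Definition prod_jac : 'M[R]_(m + s, k) := \matrix_(i, j)
  'D_(lsubmx (delta_mx 0 i : 'rV[R]_(m + s)), rsubmx (delta_mx 0 i : 'rV[R]_(m + s))) g b 0 j.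

Hypothesis dg : differentiable g b.

Lemma prod_jacE (v : 'rV[R]_(m + s)) : v *m prod_jac = 'D_(lsubmx v, rsubmx v) g b.
Proof.
rewrite deriveE//; pose D (v : 'rV[R]_(m + s)) := 'd g b (lsubmx v, rsubmx v).
have DP c x y : D (c *: x + y) = c *: D x + D y.
  by rewrite /D -linearP; congr ('d g b (_, _)); exact: linearP.
have DE : linear D by move=> c x y; exact: DP.
pose l := GRing.isLinear.Build _ _ _ _ _ DE.
pose L : {linear 'rV[R]_(m + s) -> 'rV[R]_k} := HB.pack D l.
rewrite -[RHS]/(L v) [in RHS](row_sum_delta v) linear_sum mulmx_sum_row.
apply: eq_bigr => i _; rewrite linearZ; congr (_ *: _).
by apply/rowP => j; rewrite !mxE deriveE.
Qed.

(** Turns injectivity of a differential into the nonvanishing of a Gram determinant,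
    which is an open condition. *)
Lemma prod_jac_free : row_free prod_jac <-> forall v, 'D_v g b = 0 -> v = 0.
Proof.
split=> [fJ [v w] E|iD].
  have : row_mx v w *m prod_jac = 0 *m prod_jac.
    by have := prod_jacE (row_mx v w); rewrite row_mxKl row_mxKr E mul0mx.
  by rewrite -row_mx0 => /(row_free_inj fJ)/eq_row_mx[-> ->].
apply: row_free_injective => v w /eqP; rewrite -subr_eq0 -mulmxBl prod_jacE => /eqP/iD.
set x := v - w => -[x1 x2]; apply/eqP; rewrite -subr_eq0 -/x -(hsubmxK x).
by rewrite x1 x2 row_mx0.
Qed.

End ProductJacobian.

Lemma Cinfty_prod_jac {R : realType} {m s k : nat} (O : set ('rV[R]_m * 'rV[R]_s)%type)
    (g : 'rV[R]_m * 'rV[R]_s -> 'rV[R]_k) :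
  open O -> Cinfty O g -> Cinfty O (prod_jac g).
Proof.
move=> oO cg; apply: Cinfty_mx => // i j.
set v := (lsubmx (delta_mx 0 i : 'rV[R]_(m + s)), rsubmx (delta_mx 0 i : 'rV[R]_(m + s))).
have cD := Cinfty_entry oO 0 j (Cinfty_derive v cg).
by apply: (@Cinfty_ext _ _ _ oO R _ _ _ cD) => a Oa; rewrite mxE.
Qed.

Lemma has_dim_snd {R : realType} m s (S : set ('rV[R]_m * 'rV[R]_s)%type) :
  (forall v w, S (v, w) <-> v = 0) -> has_dim S s.
Proof.
move=> SE; pose b (i : 'I_s) : ('rV[R]_m * 'rV[R]_s)%type := (0, delta_mx 0 i).
have sumE (e : 'I_s -> R) : \sum_i e i *: b i = (0, \row_i e i).
  rewrite [LHS]surjective_pairing; apply: (f_equal2 pair).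
    by rewrite linear_sum big1// => i _; exact: scaler0.
  rewrite linear_sum [RHS]row_sum_delta; apply: eq_bigr => i _; by rewrite mxE.
exists b; split=> [e e0 i|].
  have := etrans (esym (sumE e)) e0.
  by move=> /(congr1 (fun p : 'rV[R]_m * 'rV[R]_s => p.2 0 i)); rewrite !mxE.
apply/seteqP; split=> [[v w] /SE ->|_ [e _ <-]].
  exists (fun i => w 0 i) => //; apply: etrans (sumE _) _; apply: (f_equal2 pair) => //.
  by apply/rowP => i; rewrite mxE.
by have := sumE e => ->; exact/SE.
Qed.

Lemma slice_continuous (T U : topologicalType) (t : U) :
  continuous (fun u : T => (u, t)).
Proof. by move=> u; apply: cvg_pair => /=; [exact: cvg_id|exact: cvg_cst]. Qed.

Lemma Cinfty_slice {R : realType} {V W : normedModType R} (O : set V) (t : W) :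
  Cinfty O (fun b => (b, t)).
Proof.
case=> [|r]; first by move=> b _; apply: cvg_pair; [exact: cvg_id|exact: cvg_cst].
have ds b : differentiable (fun b : V => (b, t)) b by exact: differentiable_pair.
split=> [b _|v]; first exact: ds.
rewrite (_ : 'D_v _ = cst (v, 0)); first exact: Ck_cst.
by apply/funext => b; rewrite deriveE// diff_pair// !diff_val.
Qed.

Lemma derive_slice {R : realType} {V W : normedModType R} (a v : V) (t : W) :
  'D_v (fun b => (b, t)) a = (v, 0).
Proof. by rewrite deriveE ?diff_pair// ?diff_val//; exact: differentiable_pair. Qed.

(** * The Ribaucour transform in product charts *)

Section RibaucourTransform.
Context {R : realType} {m k s : nat} (L : charted 'rV[R]_m) (h : L -> 'rV[R]_k).
Hypotheses (dL : differentiable_transitions L) (hh : immersion_on h setT).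
Variables (phi : L -> R) (beta : L -> 'rV[R]_k).
Hypothesis pr : Rib_pairs h (phi, beta).
Variables (N : L -> set 'rV[R]_k) (tau : {linear 'rV[R]_s -> (L -> 'rV[R]_k)}).
Hypothesis Nnormal : forall x, N x `<=` normal_space h x.
Hypothesis tau_smooth : forall t, smooth_on setT (tau t).
Hypothesis tau_parallel : forall t x v, nabla_perp h (tau t) x v = 0.
Hypothesis tauN : forall t x, N x (tau t x).
Hypothesis tau_inj : forall x t, tau t x = 0 -> t = 0.
Hypothesis tau_onto : forall x y, N x y -> exists t, y = tau t x.

Let sh : smooth_on setT h. Proof. by case: hh. Qed.
Let sphi : smooth_on setT phi. Proof. by case: pr. Qed.
Let sbeta : smooth_on setT beta. Proof. by case: pr => _ []. Qed.
Let nbeta u : normal_space h u (beta u). Proof. by case: pr => _ []. Qed.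
Let sG : smooth_on setT (grad_vec h phi). Proof. exact: smooth_grad_vec. Qed.
Let phi0 u : phi u != 0.
Proof.
case: pr => _ _ _ /(_ u); apply: contra_neq => /= ->; exact: scale0r.
Qed.

Local Notation F t := (Rib_F h phi beta (tau t)).
Local Notation f := (Rib_transform h tau phi beta).
Local Notation nu t u := (dotv (F t u) (F t u))^-1.
Local Notation A := (tangent_mx h).

Definition tau_mx (u : L) : 'M[R]_(s, k) := \matrix_(i < s) tau (delta_mx 0 i) u.

Lemma tauE t u : tau t u = t *m tau_mx u.
Proof.
rewrite {1}[t]row_sum_delta linear_sum fct_sumE mulmx_sum_row; apply: eq_bigr => i _.
by rewrite linearZ rowK.
Qed.

Lemma tau_mx_free u : row_free (tau_mx u).
Proof.
apply: row_free_injective => v w /eqP; rewrite -subr_eq0 -mulmxBl -tauE => /eqP.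
by move=> /tau_inj/eqP; rewrite subr_eq0 => /eqP.
Qed.

Lemma Cinfty_tau_mx x : Cinfty (cod (chart_at x)) (tau_mx \o param (chart_at x)).
Proof.
have oO := cod_open (chart_at x); apply: Cinfty_mx => // i j.
have ct := Cinfty_entry oO 0 j ((smooth_onP _).1 (tau_smooth (delta_mx 0 i)) x).
by apply: (@Cinfty_ext _ _ _ oO R _ _ _ ct) => a _; rewrite /= mxE.
Qed.

Lemma tau_normal t u : normal_space h u (tau t u).
Proof. exact: Nnormal (tauN t u). Qed.

Lemma tau_tangent t u v z : normal_space h u z -> dotv (dmap (tau t) u v) z = 0.
Proof.
move=> nz; have := tau_parallel t u v; rewrite /nabla_perp => e.
by rewrite -(nproj_dot hh _ nz) e dot0v.
Qed.

Lemma smooth_Rib_F t : smooth_on setT (F t).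
Proof.
apply/smooth_onP => x; have oO := cod_open (chart_at x).
have cG := (smooth_onP _).1 sG x; have cb := (smooth_onP _).1 sbeta x.
have ct := (smooth_onP _).1 (tau_smooth t) x.
exact: (CinftyD oO (CinftyD oO cG cb) ct).
Qed.

Lemma dmap_Rib_F t u v : dmap (F t) u v =
  dmap (grad_vec h phi) u v + dmap beta u v + dmap (tau t) u v.
Proof.
have dG := smooth_dmap u sG; have db := smooth_dmap u sbeta.
have dt := smooth_dmap u (tau_smooth t).
have E1 := deriveD (v := v) (diff_derivable dG) (diff_derivable db).
have E2 := deriveD (v := v) (diff_derivable (differentiableD dG db)) (diff_derivable dt).
exact: (etrans E2 (congr1 (fun y => y + dmap (tau t) u v) E1)).
Qed.

(** [beta + h_* grad phi] contributes a tangent vector by [grad_beta_tangent], and so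
    does the parallel section. *)
Lemma dmap_Rib_F_tangent t u v z : normal_space h u z -> dotv (dmap (F t) u v) z = 0.
Proof.
move=> nz; rewrite dmap_Rib_F dotvDl (tau_tangent t v nz) addr0.
exact: (grad_beta_tangent dL hh pr v nz).
Qed.

(** [phi] is a potential of the form [<F, dh>], as [beta] and [t] are normal. *)
Lemma Rib_F_dot t u v : dotv (F t u) (dmap h u v) = dmap phi u v.
Proof.
by apply: dotv_add3; [exact: grad_vec_dot|exact: nbeta|exact: tau_normal].
Qed.

Definition chart_F (x : L) (b : ('rV[R]_m * 'rV[R]_s)%type) : 'rV[R]_k :=
  F b.2 (param (chart_at x) b.1).

Definition chart_dom (x : L) : set ('rV[R]_m * 'rV[R]_s)%type :=
  fst @^-1` cod (chart_at x).

Lemma open_chart_dom x : open (chart_dom x).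
Proof. by apply: open_fst; exact: cod_open. Qed.

Lemma Cinfty_chart (W : normedModType R) (E : L -> W) x : smooth_on setT E ->
  Cinfty (chart_dom x) (fun b => E (param (chart_at x) b.1)).
Proof.
move=> sE r; apply: (@Ck_fst _ _ _ _ r _ (E \o param (chart_at x))).
  exact: cod_open.
exact: (smooth_onP _).1.
Qed.

Lemma Cinfty_snd : Cinfty setT (@snd 'rV[R]_m 'rV[R]_s).
Proof. by move=> r; apply: Ck_linear => x; exact: cvg_snd. Qed.

Lemma Cinfty_chart_F x : Cinfty (chart_dom x) (chart_F x).
Proof.
have oO := @open_chart_dom x.
have cG := @Cinfty_chart _ _ x sG.
have cb := @Cinfty_chart _ _ x sbeta.
have cT : Cinfty (chart_dom x) (fun b => tau_mx (param (chart_at x) b.1)).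
  move=> r; apply: (@Ck_fst _ _ _ _ r _ (tau_mx \o param (chart_at x))).
    exact: cod_open.
  exact: Cinfty_tau_mx.
have c2 : Cinfty (chart_dom x) snd by apply: Cinfty_sub Cinfty_snd.
have cS := CinftyD oO (CinftyD oO cG cb) (Cinfty_mulmx oO c2 cT).
by apply: (Cinfty_ext oO _ cS) => b _; rewrite -tauE.
Qed.

Lemma derive_chart_F x b v w : chart_dom x b ->
  'D_(v, w) (chart_F x) b = 'D_v (F b.2 \o param (chart_at x)) b.1 +
                            tau w (param (chart_at x) b.1).
Proof.
case: b => a t ca; rewrite derive_partial; last first.
  exact: (Cinfty_differentiable (@Cinfty_chart_F x) ca).
congr (_ + _); set u := param (chart_at x) a.
have lin_cont : continuous (mulmxr (tau_mx u) : 'rV[R]_s -> 'rV[R]_k).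
  move=> t'; apply: (@Cinfty_continuous _ _ setT _ (fun y => y *m tau_mx u)) => //.
  apply: Cinfty_mulmx; [exact: openT| |exact: Cinfty_cst].
  by move=> r; apply: (@Ck_linear _ _ _ r _ idfun) => y; exact: cvg_id.
have -> : (fun t' => chart_F x (a, t')) =
    cst (grad_vec h phi u + beta u) + (mulmxr (tau_mx u) : 'rV[R]_s -> 'rV[R]_k).
  by apply/funext => t'; rewrite -[RHS]/(_ + _ + t' *m tau_mx u) -tauE.
rewrite deriveD; [|exact: derivable_cst|]; last first.
  by apply: diff_derivable; exact: linear_differentiable.
by rewrite derive_cst add0r derive_linear// tauE.
Qed.

Lemma dmap_transform u t v w : F t u != 0 ->
  dmap f (u, t) (v, w) = refl (F t u)
    (dmap h u v - (2 * phi u * nu t u) *: (dmap (F t) u v + tau w u)).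
Proof.
move=> F0; have cc := cod_center u; have uE := param_center u.
pose b : ('rV[R]_m * 'rV[R]_s)%type := (coord (chart_at u) u, t).
have Ob : chart_dom u b by [].
have FE : chart_F u b = F t u by rewrite /chart_F /= uE.
pose H := (h \o param (chart_at u)) \o @fst 'rV[R]_m 'rV[R]_s.
pose P := (phi \o param (chart_at u)) \o @fst 'rV[R]_m 'rV[R]_s.
have dh := smooth_dmap u sh; have dp := smooth_dmap u sphi.
have HE : 'D_(v, w) H b = dmap h u v by exact: derive_fst.
have PE : 'D_(v, w) P b = dmap phi u v by exact: derive_fst.
have DFE : 'D_(v, w) (chart_F u) b = dmap (F t) u v + tau w u.
  by rewrite derive_chart_F//= uE.
have := @derive_ribaucour _ _ _ (chart_F u) b (v, w)
  (Cinfty_differentiable (@Cinfty_chart_F u) Ob) _ H P.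
rewrite HE PE DFE FE Rib_F_dot => /(_ F0) E.
have -> : phi u = P b by rewrite /P /= uE.
apply: (etrans _ (E _ _ erefl)); first by [].
  by apply: differentiable_comp (differentiable_fst b) dh.
by apply: differentiable_comp (differentiable_fst b) dp.
Qed.

(** * Tangent and normal spaces of the transform *)

Local Notation M := (prod_charted 'rV[R]_s L).
Local Notation M0 := (Rib_regular h tau phi beta).
Local Notation c t u := (2 * phi u * nu t u).

Let dM : differentiable_transitions M. Proof. exact: prod_transitions. Qed.

(** Rows spanning the tangent space of the leaf through [(u, t)], reflected by [F]. *)
Definition leaf_mx (t : 'rV[R]_s) (u : L) : 'M[R]_(m, k) :=
  A u - c t u *: jacobian (F t \o param (chart_at u)) (coord (chart_at u) u).

Lemma leaf_mxE t u v : v *m leaf_mx t u = dmap h u v - c t u *: dmap (F t) u v.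
Proof.
have dF := smooth_dmap u (smooth_Rib_F t).
have e1 := esym (tangent_mxE hh u v); have e2 := esym (deriveEjacobian v dF).
rewrite /leaf_mx mulmxBr -scalemxAr.
exact: (f_equal2 (fun x y => x - c t u *: y) e1 e2).
Qed.

Lemma dmap_transformE u t v w : F t u != 0 ->
  dmap f (u, t) (v, w) = refl (F t u) (v *m leaf_mx t u - c t u *: tau w u).
Proof.
move=> F0; rewrite (dmap_transform v w F0) leaf_mxE scalerDr opprD addrA//.
Qed.

Lemma leaf_mx_range t u v : exists y : 'rV[R]_m, v *m leaf_mx t u = y *m A u.
Proof.
apply: (tangentP hh) => z nz; rewrite leaf_mxE dotvBl dotvZl (dmap_Rib_F_tangent t v nz).
by rewrite mulr0 subr0; exact: nz.
Qed.

Lemma scale_neq0 t u : F t u != 0 -> c t u != 0.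
Proof.
move=> F0; apply: mulf_neq0; last by apply: invr_neq0; exact: dotv_neq0.
by apply: mulf_neq0; [rewrite pnatr_eq0|exact: phi0].
Qed.

Lemma regular_free t u : M0 (u, t) -> row_free (leaf_mx t u).
Proof.
move=> [F0 iD]; apply: row_free_injective => v v' vv'.
suff [] : (v, 0 : 'rV[R]_s) = (v', 0) by [].
by apply: iD; rewrite !(dmap_transformE _ _ F0) vv'.
Qed.

(** At a regular point [leaf_mx] is injective, and it takes its values in the tangent
    space of [h], which has the same dimension. *)
Lemma leaf_mx_onto t u : M0 (u, t) ->
  forall y : 'rV[R]_m, exists x : 'rV[R]_m, y *m A u = x *m leaf_mx t u.
Proof.
move=> r; apply: row_space_full; first exact: regular_free.
exact: leaf_mx_range.
Qed.

Lemma NperpE u y : Nperp h N u y <->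
  (forall v : 'rV[R]_m, dotv (v *m A u) y = 0) /\
  (forall w : 'rV[R]_s, dotv (w *m tau_mx u) y = 0).
Proof.
split=> [[/(normal_spaceE hh) ny Ny]|[ny Ny]]; split=> //.
- by move=> w; rewrite -tauE; apply: Ny; exact: tauN.
- exact/(normal_spaceE hh).
- by move=> z /tau_onto[w ->]; rewrite tauE.
Qed.

(** The tangent space of [f] is the image under the reflection of the sum of the
    tangent space of [h] and of [N]. *)
Lemma normal_transform t u z : M0 (u, t) ->
  normal_space f (u, t) z <-> Nperp h N u (refl (F t u) z).
Proof.
move=> r; have F0 := r.1; have c0 := scale_neq0 F0; split=> [nz|/NperpE[Az Tz] [v w]].
  (* Tangent vectors of [h] are attained by horizontal vectors, those of [N] by
     vertical ones. *)
  apply/NperpE; split=> [y|w].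
    have [x ->] := leaf_mx_onto r y; have := nz (x, 0).
    by rewrite (dmap_transformE _ _ F0) linear0 scaler0 subr0 refl_dot.
  have := nz (0, w); rewrite (dmap_transformE _ _ F0) mul0mx sub0r refl_dot dotvNl dotvZl.
  by move=> /eqP; rewrite oppr_eq0 mulf_eq0 (negPf c0) tauE => /eqP.
rewrite (dmap_transformE _ _ F0) refl_dot dotvBl dotvZl tauE Tz mulr0 subr0.
by have [y ->] := leaf_mx_range t u v; exact: Az.
Qed.

Let AT0 u (v : 'rV[R]_m) (w : 'rV[R]_s) : dotv (v *m A u) (w *m tau_mx u) = 0.
Proof. by rewrite -tauE; exact: (normal_spaceE hh u _).1 (tau_normal w u) v. Qed.

Lemma oproj_NperpE u y :
  oproj (Nperp h N u) y = y - rowproj (A u) y - rowproj (tau_mx u) y.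
Proof.
apply: oproj_compl2; [exact: tangent_mx_free|exact: tau_mx_free|exact: AT0|].
exact: NperpE.
Qed.

Lemma oproj_Nperp u y : Nperp h N u (oproj (Nperp h N u) y).
Proof.
rewrite oproj_NperpE; have fA := tangent_mx_free hh u; have fT := tau_mx_free u.
apply/NperpE; split=> v.
  rewrite dotvBr rowproj_orth// sub0r.
  by have [x ->] := rowproj_sub (tau_mx u) y; rewrite AT0 oppr0.
rewrite addrAC dotvBr rowproj_orth// sub0r.
by have [x ->] := rowproj_sub (A u) y; rewrite dotvC AT0 oppr0.
Qed.

Lemma oproj_Nperp_dot u y z : Nperp h N u z -> dotv (oproj (Nperp h N u) y) z = dotv y z.
Proof.
move=> /NperpE[Az Tz]; rewrite oproj_NperpE !dotvBl.
have [x ->] := rowproj_sub (A u) y; have [x' ->] := rowproj_sub (tau_mx u) y.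
by rewrite Az Tz !subr0.
Qed.

Lemma Nperp_sub u y z : Nperp h N u y -> Nperp h N u z -> Nperp h N u (y - z).
Proof.
move=> /NperpE[Ay Ty] /NperpE[Az Tz]; apply/NperpE.
by split=> v; rewrite dotvBr ?Ay ?Az ?Ty ?Tz subrr.
Qed.

Lemma NperpZ u y r : Nperp h N u y -> Nperp h N u (r *: y).
Proof.
by move=> /NperpE[Ay Ty]; apply/NperpE; split=> v; rewrite dotvZr ?Ay ?Ty mulr0.
Qed.

Lemma oproj_Nperp_id u y : Nperp h N u y -> oproj (Nperp h N u) y = y.
Proof.
move=> Ny; apply: oprojE => //; first exact: Nperp_sub.
by move=> z _; rewrite subrr dot0v.
Qed.

Lemma smooth_oproj_Nperp (y : L -> 'rV[R]_k) : smooth_on setT y ->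
  smooth_on setT (fun u => oproj (Nperp h N u) (y u)).
Proof.
move=> sy; apply/smooth_onP => x; have oO := cod_open (chart_at x).
have cy := (smooth_onP _).1 sy x.
have cP := Cinfty_rowproj oO (@chart_jac_free _ _ _ _ _ dL hh x) (Cinfty_chart_jac hh x) cy.
have cT := Cinfty_rowproj oO (fun a _ => tau_mx_free (param (chart_at x) a))
  (Cinfty_tau_mx x) cy.
apply: (Cinfty_ext oO _ (CinftyB oO (CinftyB oO cy cP) cT)) => a ca /=.
have nE z := normal_space_chart dL hh z ca.
apply/esym/oproj_compl2; [exact: chart_jac_free|exact: tau_mx_free| |].
  by move=> v w; rewrite -tauE; apply: (nE _).1; exact: tau_normal.
move=> z; split=> [[nz Nz]|[nz Nz]]; split; first exact/nE.
- by move=> w; rewrite -tauE; exact: Nz.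
- exact/nE.
- by move=> _ /tau_onto[w ->]; rewrite tauE.
Qed.

Local Notation bb := (beta_bar h N phi beta).

Lemma beta_bar_Nperp u : Nperp h N u (bb u).
Proof. by rewrite /beta_bar; apply: NperpZ; exact: oproj_Nperp. Qed.

(** This is the definition of [beta_bar]. *)
Lemma Rib_F_dot_Nperp t u z : Nperp h N u z ->
  dotv (F t u) z = - phi u * dotv (bb u) z.
Proof.
move=> Nz; have [Az Tz] := (NperpE _ _).1 Nz.
rewrite /beta_bar dotvZl (oproj_Nperp_dot _ Nz) mulrA mulrNN mulfV ?phi0// mul1r.
rewrite Rib_FE !dotvDl (tangent_mxE hh) Az add0r tauE Tz addr0//.
Qed.

Lemma smooth_beta_bar : smooth_on setT bb.
Proof.
apply/smooth_onP => x; have oO := cod_open (chart_at x).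
have cp := CinftyV oO (fun a _ => phi0 (param (chart_at x) a)) ((smooth_onP _).1 sphi x).
have cb := (smooth_onP _).1 (smooth_oproj_Nperp sbeta) x.
by apply: (Cinfty_ext oO _ (CinftyN oO (CinftyZ oO cp cb))) => a _; rewrite /= /beta_bar scaleNr.
Qed.

(** * Regular points and smoothness of the transform *)

Definition chart_reg (x : L) : set ('rV[R]_m * 'rV[R]_s)%type :=
  [set b | chart_dom x b /\ dotv (chart_F x b) (chart_F x b) != 0].

Lemma open_chart_reg x : open (chart_reg x).
Proof.
apply: open_Cinfty_neq0; first exact: open_chart_dom.
by apply: Cinfty_dotv; [exact: open_chart_dom| |]; exact: Cinfty_chart_F.
Qed.

Lemma chart_reg_F x b : chart_reg x b -> chart_F x b != 0.
Proof. by move=> [_]; apply: contra_neq => ->; rewrite dotv0. Qed.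

Lemma chart_regI x b : chart_dom x b -> chart_F x b != 0 -> chart_reg x b.
Proof. by move=> db F0; split=> //; exact: dotv_neq0. Qed.

(** The point with coordinates [b] in the product chart at [(x, t)], which is the same
    for all [t]. *)
Definition chart_point (x : L) (b : 'rV[R]_m * 'rV[R]_s) : M :=
  (param (chart_at x) b.1, b.2).

Lemma Cinfty_transform x : Cinfty (chart_reg x) (f \o chart_point x).
Proof.
have oO := @open_chart_reg x.
have sub : chart_reg x `<=` chart_dom x by move=> b [].
have cF := Cinfty_sub sub (@Cinfty_chart_F x).
have cp := Cinfty_sub sub (@Cinfty_chart _ _ x sphi).
have ch := Cinfty_sub sub (@Cinfty_chart _ _ x sh).
apply: (CinftyB oO ch); apply: CinftyZ => //; apply: CinftyM => //.
  by apply: CinftyM => //; exact: Cinfty_cst.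
by apply: CinftyV => //; [move=> b []|exact: Cinfty_dotv].
Qed.

Lemma Cinfty_reflected (xi : L -> 'rV[R]_k) x : smooth_on setT xi ->
  Cinfty (chart_reg x) (fun b => refl (chart_F x b) (xi (param (chart_at x) b.1))).
Proof.
move=> sxi; have sub : chart_reg x `<=` chart_dom x by move=> b [].
apply: Cinfty_refl; [exact: open_chart_reg|exact: chart_reg_F| |].
  exact: Cinfty_sub (@Cinfty_chart_F x).
exact: Cinfty_sub (@Cinfty_chart _ _ x sxi).
Qed.

Definition center (q : M) : 'rV[R]_m * 'rV[R]_s :=
  (coord (chart_at q.1) q.1, q.2).

Lemma chart_point_center q : chart_point q.1 (center q) = q.
Proof. by case: q => u t; rewrite /chart_point /center /= param_center. Qed.

Lemma center_reg (q : M) : F q.2 q.1 != 0 -> chart_reg q.1 (center q).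
Proof.
move=> F0; apply: chart_regI; first exact: cod_center.
by rewrite /chart_F /center /= param_center.
Qed.

Lemma differentiable_transform (q : M) : F q.2 q.1 != 0 ->
  differentiable (f \o param (chart_at q)) (coord (chart_at q) q).
Proof.
move=> F0; exact: (Cinfty_differentiable (@Cinfty_transform q.1) (center_reg F0)).
Qed.

Lemma derive_transform x b v : chart_reg x b ->
  'D_v (f \o chart_point x) b =
  dmap f (chart_point x b) (transition (M := M) (x, b.2) b v).
Proof.
move=> rb; have [db _] := rb; have F0 := chart_reg_F rb.
have := @chart_change _ _ M dM _ f (x, b.2) b db.
by move=> /(_ (@differentiable_transform (chart_point x b) F0))[_]; exact.
Qed.

Lemma regular_chart x b : chart_reg x b ->
  M0 (chart_point x b) <-> row_free (prod_jac (f \o chart_point x) b).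
Proof.
move=> rb; have F0 := chart_reg_F rb; have [db _] := rb.
have df := Cinfty_differentiable (@Cinfty_transform x) rb.
have dfq := @differentiable_transform (chart_point x b) F0.
rewrite (prod_jac_free df); split=> [[_ /(dmap_injectiveP dfq) iD] v|iD].
  by rewrite (derive_transform v rb) => /iD; exact: transition_inj.
split; first exact: F0.
apply: (dmap_injectiveP dfq).2 => v.
have [w wE] := transition_surj (x := (x, b.2) : M) dM v db.
move=> dv; have w0 : w = 0.
  by apply: iD; apply: etrans (derive_transform w rb) _; rewrite wE.
by rewrite -wE w0 [LHS]derive0.
Qed.

(** Regularity at all points near [q] is read in the one chart at [q], where it is the
    nonvanishing of a smooth determinant. *)
Lemma open_regular : open M0.
Proof.
rewrite openE => q rq; have F0 := rq.1; have rc := center_reg F0; pose x := q.1.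
have oO := @open_chart_reg x; pose J := prod_jac (f \o chart_point x).
have cJ : Cinfty (chart_reg x) J by apply: Cinfty_prod_jac => //; exact: Cinfty_transform.
have cD : Cinfty (chart_reg x) (fun b => \det (J b *m (J b)^T)).
  by apply: Cinfty_det => //; apply: Cinfty_mulmx => //; exact: Cinfty_trmx.
have JE b : (\det (J b *m (J b)^T) != 0) = row_free (J b).
  by rewrite -gram_unit unitmxE unitfE.
have oU := open_Cinfty_neq0 oO cD.
have Uc : [set b | chart_reg x b /\ \det (J b *m (J b)^T) != 0] (center q).
  split; first exact: rc.
  by rewrite JE; apply: (regular_chart rc).1; rewrite chart_point_center.
have dq : dom (chart_at q) q by exact: mem_chart_at.
apply: filterS (nbhs_coord dq (open_nbhs_nbhs (conj oU Uc))) => q' [dq' [rb]].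
rewrite JE => /(regular_chart rb); rewrite /chart_point.
by rewrite -[X in M0 X -> _]/(param (chart_at q) (coord (chart_at q) q')) coordK.
Qed.

Lemma regular_sub x (b : 'rV[R]_m * 'rV[R]_s) :
  chart_dom x b -> M0 (chart_point x b) -> chart_reg x b.
Proof. by move=> db [F0 _]; exact: chart_regI. Qed.

Lemma immersion_transform : immersion_on f M0.
Proof.
split; last by move=> q [].
move=> q _; apply: Cinfty_sub (@Cinfty_transform q.1) => b [db rb].
exact: regular_sub.
Qed.

Lemma smooth_reflected (xi : L -> 'rV[R]_k) : smooth_on setT xi ->
  smooth_on M0 (fun q => refl (F q.2 q.1) (xi q.1)).
Proof.
move=> sxi q _; apply: Cinfty_sub (@Cinfty_reflected xi q.1 sxi) => b [db rb].
exact: regular_sub.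
Qed.

(** The derivative of [P xi] by [derive_refl], which applies because [dF] is tangent
    to [h] up to vectors of [N]; the factor comes from
    [<F, xi> = - phi <beta_bar, xi>]. *)
Lemma dmap_reflected (xi : L -> 'rV[R]_k) u t v w : F t u != 0 ->
  smooth_on setT xi -> Nperp h N u (xi u) ->
  dmap (fun q : M => refl (F q.2 q.1) (xi q.1)) (u, t) (v, w) =
  refl (F t u) (dmap xi u v +
    (c t u * dotv (bb u) (xi u)) *: (dmap (F t) u v + tau w u)).
Proof.
move=> F0 sxi Nxi; have uE := param_center u.
pose b : ('rV[R]_m * 'rV[R]_s)%type := (coord (chart_at u) u, t).
have Ob : chart_dom u b by exact: cod_center.
have FE : chart_F u b = F t u by rewrite /chart_F /= uE.
pose X := (xi \o param (chart_at u)) \o @fst 'rV[R]_m 'rV[R]_s.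
have dxi := smooth_dmap u sxi.
have XE : 'D_(v, w) X b = dmap xi u v by exact: derive_fst.
have Xb : X b = xi u by rewrite /X /= uE.
have dX : differentiable X b by exact: differentiable_comp (differentiable_fst b) dxi.
have DFE : 'D_(v, w) (chart_F u) b = dmap (F t) u v + tau w u.
  by rewrite derive_chart_F//= uE.
have FX : dotv ('D_(v, w) (chart_F u) b) (X b) = 0.
  rewrite DFE Xb dotvDl (dmap_Rib_F_tangent t v Nxi.1) add0r.
  exact: Nxi.2 (tauN w u).
have F0' : chart_F u b != 0 by rewrite FE.
have dF := Cinfty_differentiable (@Cinfty_chart_F u) Ob.
have E := derive_refl dF F0' dX FX.
apply: (etrans E); rewrite FE DFE XE Xb (Rib_F_dot_Nperp t Nxi); congr refl.
by rewrite -scaleNr; congr (_ + _ *: _); ring.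
Qed.

(** Differentiate [<df W, P xi> = 0]: the field [P xi] is normal to [f] on the whole
    open set of regular points. *)
Lemma sff_reflected (xi : L -> 'rV[R]_k) u t Z W : M0 (u, t) ->
  smooth_on setT xi -> (forall u, Nperp h N u (xi u)) ->
  dotv ('D_Z ('D_W (f \o param (chart_at ((u, t) : M))))
          (coord (chart_at ((u, t) : M)) (u, t))) (refl (F t u) (xi u)) =
  - dotv (dmap f (u, t) W) (dmap (fun q : M => refl (F q.2 q.1) (xi q.1)) (u, t) Z).
Proof.
move=> r sxi Nxi; have F0 := r.1; have rb := center_reg (q := (u, t)) F0.
pose O : set ('rV[R]_m * 'rV[R]_s)%type :=
  [set b | cod (chart_at ((u, t) : M)) b /\ M0 (param (chart_at ((u, t) : M)) b)].
have oO : open O by apply: open_param; exact: open_regular.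
have Oc : O (center (u, t)).
  split; first exact: cod_center.
  by have := r; rewrite -[X in M0 X -> _](chart_point_center (u, t)).
pose X b := refl (chart_F u b) (xi (param (chart_at u) b.1)).
have dX : differentiable X (center (u, t)).
  exact: Cinfty_differentiable (@Cinfty_reflected xi u sxi) rb.
pose fu := f \o chart_point u.
have dfW : differentiable ('D_W fu) (center (u, t)).
  exact: Cinfty_differentiable (Cinfty_derive W (@Cinfty_transform u)) rb.
have orth b : O b -> dotv ('D_W fu b) (X b) = 0.
  move=> [db rb']; rewrite (derive_transform W (regular_sub db rb')).
  apply: (normal_transform (X b) rb').2; rewrite /X reflK; first exact: Nxi.
  exact: rb'.1.
have E := derive_orthogonal Z oO Oc orth dfW dX.
by move: E; rewrite {1}/X /chart_F /center /= param_center.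
Qed.

(** * The principal normal of the transform *)

Hypothesis hE : forall x, Ew h N phi beta x = [set 0].

Local Notation eta := (Rib_eta h N tau phi beta).

Lemma Rib_etaE u t : eta (u, t) = refl (F t u) (bb u).
Proof. by []. Qed.

Lemma eta_normal u t : M0 (u, t) -> normal_space f (u, t) (eta (u, t)).
Proof.
move=> r; apply: (normal_transform _ r).2; rewrite Rib_etaE reflK; last exact: r.1.
exact: beta_bar_Nperp.
Qed.

Lemma nproj_transform u t y : M0 (u, t) ->
  Defs.nproj f (u, t) y = refl (F t u) (oproj (Nperp h N u) (refl (F t u) y)).
Proof.
move=> r; have F0 := r.1; have nE := fun z => normal_transform z r.
apply: oprojE.
- by move=> a b na nb v; rewrite dotvBr na nb subrr.
- by apply: (nE _).2; rewrite reflK//; exact: oproj_Nperp.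
- move=> z /nE Nz; rewrite dotvBl refl_dot oproj_Nperp_dot// refl_dot reflK//.
  exact: subrr.
Qed.

Lemma nproj_transform_dot u t y z : M0 (u, t) -> Nperp h N u z ->
  dotv (Defs.nproj f (u, t) y) (refl (F t u) z) = dotv y (refl (F t u) z).
Proof.
move=> r Nz; rewrite (nproj_transform y r) (refl_isometry _ _ r.1).
by rewrite (oproj_Nperp_dot _ Nz) refl_dot.
Qed.

(** The vector [z] is extended to the field [xi] by projecting it onto the spaces
    [N^perp]; then [sff_reflected] and [dmap_reflected] express the second fundamental
    form of [f] by first derivatives of [xi]. The vector [y'] is the one with
    [dh y' = dh y - c dF y]. *)
Lemma sff_minus_metric u t v w y w' y' z : M0 (u, t) -> Nperp h N u z ->
  y *m leaf_mx t u = y' *m A u ->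
  dotv (sff f (u, t) (v, w) (y, w') -
        metric f (u, t) (v, w) (y, w') *: eta (u, t)) (refl (F t u) z) =
  dotv (sff h u v y') z - dotv (bb u) z * metric h u v y'.
Proof.
move=> r Nz yE; have F0 := r.1.
pose xi u' := oproj (Nperp h N u') z.
have sxi : smooth_on setT xi.
  apply: smooth_oproj_Nperp => x _; exact: Cinfty_cst.
have Nxi u' : Nperp h N u' (xi u') by exact: oproj_Nperp.
have xiu : xi u = z by exact: oproj_Nperp_id.
have sE : dotv (sff f (u, t) (v, w) (y, w')) (refl (F t u) z) = - dotv
    (dmap f (u, t) (y, w')) (dmap (fun q : M => refl (F q.2 q.1) (xi q.1)) (u, t) (v, w)).
  apply: etrans (nproj_transform_dot _ r Nz) _; rewrite -[in LHS]xiu.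
  exact: sff_reflected.
rewrite dotvBl dotvZl sE Rib_etaE (refl_isometry _ _ F0).
rewrite (dmap_reflected v w F0 sxi (Nxi u)) xiu /metric.
rewrite !(dmap_transformE _ _ F0) !(refl_isometry _ _ F0) yE leaf_mxE -tangent_mxE//.
have Tn t' := tau_normal t' u.
apply: umbilic_identity.
- exact: Tn.
- exact: Tn.
- by apply: dmap_Rib_F_tangent; exact: Tn.
- have := derive_orthogonal v (cod_open (chart_at u)) (cod_center u) _
    (smooth_dmap u (tau_smooth w')) (smooth_dmap u sxi).
  have o b : cod (chart_at u) b ->
    dotv ((tau w' \o param (chart_at u)) b) ((xi \o param (chart_at u)) b) = 0.
    by move=> _; apply: (Nxi _).2; exact: tauN.
  move=> /(_ o) E; move: E; rewrite /= param_center => E.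
  have E0 : dotv (dmap (tau w') u v) (xi u) = 0 by apply: tau_tangent; exact: (Nxi u).1.
  by apply: oppr_inj; rewrite oppr0 -E; exact: E0.
- have := sff_normal_field dL hh u v y' sxi (fun u' => (Nxi u').1).
  by rewrite xiu => ->; rewrite opprK.
Qed.

(** The right-hand side of [sff_minus_metric] involves only the component [v], and it
    vanishes for all [z] and [y'] exactly when [v] lies in [E(w) = 0]. *)
Lemma Edistr_transform u t v w : M0 (u, t) -> Edistr f eta (u, t) (v, w) <-> v = 0.
Proof.
move=> r; have F0 := r.1; split=> [E|->].
  suff : Ew h N phi beta u v by rewrite hE.
  move=> y'; apply: oprojE; first exact: Nperp_sub.
    exact: NperpZ (beta_bar_Nperp u).
  move=> z Nz; have [y yE] := leaf_mx_onto r y'.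
  have := sff_minus_metric v w 0 r Nz (esym yE).
  rewrite E subrr dot0v dotvBl dotvZl => e.
  by rewrite [X in _ - X]mulrC; exact: esym e.
(* [d] is normal to [f] and orthogonal to the normal vector [refl (refl d) = d]. *)
move=> [y w']; apply/eqP; rewrite -subr_eq0; apply/eqP; set d := _ - _.
have nd : normal_space f (u, t) d.
  move=> V; rewrite dotvBr dotvZr (eta_normal r) mulr0 subr0.
  rewrite [sff _ _ _ _](nproj_transform _ r); apply: (normal_transform _ r).2.
  by rewrite reflK//; exact: oproj_Nperp.
have Nz := (normal_transform _ r).1 nd.
have [y' yE] := leaf_mx_range t u y.
have := sff_minus_metric 0 w w' r Nz yE; rewrite -/d reflK// => e.
apply: dotv_eq0; apply: etrans e _.
have h0 : dmap h u 0 = 0 by exact: derive0.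
rewrite /metric h0 dot0v mulr0 subr0.
by apply: etrans (nproj_dot hh _ Nz.1) _; rewrite derive0 dot0v.
Qed.

(** The reflection is an isometry, and the tangent space of [h] is orthogonal to [N]:
    the two factors are orthogonal for the metric of [f]. *)
Lemma conullity_transform u t y w : M0 (u, t) -> conullity f eta (u, t) (y, w) <-> w = 0.
Proof.
move=> r; have F0 := r.1; have c0 := scale_neq0 F0.
have Tn t' := tau_normal t' u.
have mE v w' : metric f (u, t) (0, v) (y, w') = c t u ^+ 2 * dotv (tau v u) (tau w' u).
  rewrite /metric !(dmap_transformE _ _ F0) (refl_isometry _ _ F0) mul0mx sub0r.
  have [y' ->] := leaf_mx_range t u y.
  have TA : dotv (tau v u) (y' *m A u) = 0.
    by rewrite dotvC -(tangent_mxE hh); exact: Tn.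
  by rewrite dotvNl dotvBr !dotvZl !dotvZr TA; ring.
split=> [C|-> [v w'] /(Edistr_transform _ _ r) ->]; last first.
  by rewrite mE linear0 dotv0 mulr0.
apply: (@tau_inj u); apply: dotv_eq0.
have := C (0, w) ((Edistr_transform 0 w r).2 erefl); rewrite mE => /eqP.
by rewrite mulf_eq0 expf_eq0 (negPf c0) andbF => /eqP.
Qed.

(** The derivative of [eta] along a vector [w] of the second factor is the reflection
    of a multiple of [w], hence tangent to [f], by [dmap_reflected] with
    [xi = beta_bar]. *)
Lemma eta_dupin : (0 < s)%N -> dupin_principal_normal f M0 eta s.
Proof.
move=> s0; split; first split=> //.
- exact: smooth_reflected smooth_beta_bar.
- by move=> [u t] r; exact: eta_normal.
- by move=> [u t] r; apply: has_dim_snd => v w; exact: Edistr_transform.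
- move=> [u t] r [v w] /(Edistr_transform _ _ r) ->; have F0 := r.1.
  rewrite /nabla_perp (nproj_transform _ r).
  rewrite [dmap eta _ _](dmap_reflected 0 w F0 smooth_beta_bar (beta_bar_Nperp u)).
  rewrite (reflK _ F0) [X in refl _ X](_ : _ = 0) ?refl0//.
  apply: oprojE; first exact: Nperp_sub.
    by apply/NperpE; split=> ?; rewrite dotv0.
  move=> z Nz; rewrite subr0 [dmap bb u 0]derive0 [dmap (F t) u 0]derive0 !add0r dotvZl.
  by rewrite (Nz.2 _ (tauN w u)) mulr0.
Qed.

(** * Leaves of the conullity *)

Hypothesis hL : smooth_manifold L.

Local Notation slice t := [set u : L | M0 (u, t)].
Local Notation leaf_of u t := (connected_component (slice t) u).
Local Notation D := (conullity f eta).

Lemma open_slice t : open (slice t).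
Proof.
apply: (@open_comp _ _ (fun u : L => (u, t) : M)); last exact: open_regular.
by move=> u _; exact: slice_continuous.
Qed.

Lemma leaf_integral u t : M0 (u, t) ->
  integral_manifold M0 D (leaf_of u t) (fun u' : L => (u', t) : M).
Proof.
move=> r; have lM y : leaf_of u t y -> M0 (y, t).
  by move=> /connected_component_sub.
have lE y b : cod (chart_at y) b ->
    (b, t) = local_expr (M := M) (fun u' : L => (u', t)) y b.
  by move=> cb; rewrite /local_expr /= paramK.
have dE y v : mdiff (M := M) (fun u' : L => (u', t)) y v = (v, 0).
  rewrite -(derive_slice (coord (chart_at y) y) v t); apply/esym.
  exact: derive_on (cod_open (chart_at y)) (cod_center y) (lE y).
split; first exact: hL.
- split; first exact: (@open_component _ _ L (slice t) u (@open_slice t)).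
  split; first exact: component_connected.
  by exists u; exact: connected_component_refl.
- move=> y ly; split.
    exact: slice_continuous.
  have oO := cod_open (chart_at y).
  apply: Cinfty_sub (Cinfty_ext oO (lE y) (Cinfty_slice (cod (chart_at y)) t)).
  by move=> a [].
- by move=> y y' _ _ [].
- move=> y /lM ry; split; first exact: ry.
    by move=> v w; rewrite !dE => -[].
  apply/seteqP; split=> [_ [v _ <-]|[v w] /(conullity_transform _ _ ry) ->].
    by rewrite dE; apply/(conullity_transform _ _ ry).
  by exists v => //; rewrite dE.
Qed.

(** The conullity consists of the vectors with vanishing second component, so that
    the second component of [g] has zero differential on a connected set. The first
    component then stays in one connected component of the slice. *)
Lemma integral_sub_leaf (K : charted 'rV[R]_m) (U : set K) (g : K -> M) y0 :
  integral_manifold M0 D U g -> U y0 ->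
  forall y, U y -> (g y).2 = (g y0).2 /\ leaf_of (g y0).1 (g y0).2 (g y).1.
Proof.
move=> [sK [oU [cU _]] sg _ ig] Uy0.
have g2 y : U y -> (g y).2 = (g y0).2.
  move=> Uy; apply/rowP => i.
  have dl z : U z -> differentiable (local_expr g z) (coord (chart_at z) z).
    move=> Uz; have [_ cz] := sg z Uz; apply: Cinfty_differentiable cz _.
    split; [exact: cod_center|by rewrite param_center|].
    by rewrite param_center; exact: mem_chart_at.
  pose G z : R := (g z).2 0 i; pose p (q : 'rV[R]_m * 'rV[R]_s) : R := q.2 0 i.
  have dp q : differentiable p q.
    exact: differentiable_comp (differentiable_snd q) (differentiable_coord _ 0 i).
  have Dp q v : 'D_v p q = v.2 0 i.
    apply: etrans (esym (derive_entry v 0 i (differentiable_snd q))) _.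
    by rewrite derive_linear// => x; exact: cvg_snd.
  apply: (dmap0_cst (smooth_manifold_transitions sK) (F := G) oU cU) => //.
    by move=> z Uz; exact: differentiable_comp (dl z Uz) (dp _).
  move=> z v Uz; have := derive_comp v (dl z Uz) (dp _); rewrite Dp => E.
  apply: (etrans E); rewrite -[LHS]/((mdiff g z v).2 0 i).
  have [rz _ Dz] := ig z Uz.
  have : D (g z) (mdiff g z v) by rewrite -Dz; exists v.
  move: (g z) rz (mdiff g z v) => [a b] rz [c d] /(conullity_transform _ _ rz) -> /=.
  by rewrite mxE.
move=> y Uy; split; first exact: g2.
apply: (@connected_component_max _ _ ((fst \o g) @` U)).
- by exists y0.
- by move=> _ [z Uz <-] /=; have [+ _ _] := ig z Uz; rewrite -(g2 z Uz); case: (g z).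
- apply: connected_continuous_connected cU _; apply: continuous_in_subspaceT => z.
  rewrite inE => Uz; apply: continuous_comp; last exact: cvg_fst.
  by have [] := sg z Uz.
- by exists y.
Qed.

(** An integral manifold is contained in a component of a slice as soon as it meets
    it, so that these components are the maximal ones. *)
Lemma leaf_transformP S : leaf M0 D m S <->
  exists2 q, M0 q & S = [set ((u, q.2) : M) | u in leaf_of q.1 q.2].
Proof.
split=> [[[K [U [g [ig SE]]]] maxS]|[[u t] r SE]].
  have [_ [_ [_ [y0 Uy0]]] _ _ /(_ y0 Uy0)[r _ _]] := ig; exists (g y0) => //.
  apply/seteqP; split.
    rewrite SE => _ [y Uy <-]; have [g2 g1] := integral_sub_leaf ig Uy0 Uy.
    by exists (g y).1 => //; rewrite -g2; case: (g y).
  have r' : M0 ((g y0).1, (g y0).2) by case: (g y0) r.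
  apply: maxS (leaf_integral r') _; exists (g y0); split.
    by rewrite SE; exists y0.
  by exists (g y0).1; [exact: connected_component_refl|case: (g y0)].
split.
  exists L, (leaf_of u t), (fun u' => (u', t)); split; [exact: leaf_integral|exact: SE].
move=> K U g ig [z [Sz [y0 Uy0 zE]]] _ [y Uy <-].
have [g2 g1] := integral_sub_leaf ig Uy0 Uy.
move: Sz; rewrite SE -zE => -[v /= lv vE].
have tE : t = (g y0).2 by rewrite -vE.
exists (g y).1; last by rewrite /= tE -g2; case: (g y).
by move: g1; rewrite -vE /=; exact: connected_component_trans.
Qed.

End RibaucourTransform.

(** * Parallel sections of the normal subbundle *)

Lemma simply_connected_connected {R : realType} (T : topologicalType) :
  simply_connected R T -> connected [set: T].
Proof.
move=> [path _] B [x Bx] oB cB.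
suff compT : connected_component setT x = setT.
  have cT : connected [set: T] by rewrite -compT; exact: component_connected.
  by apply: cT => //; exists x.
apply/seteqP; split=> // y _; have [g [cg g0 g1]] := path x y.
apply: (@connected_component_max _ setT (g @` `[0, 1])) => //.
- by exists 0; [rewrite /= in_itv /= lexx ler01|exact: g0].
- by apply: connected_continuous_connected cg; exact: segment_connected.
- by exists 1; [rewrite /= in_itv /= lexx ler01|exact: g1].
Qed.

Section ParallelSections.
Context {R : realType} {m k s : nat} (L : charted 'rV[R]_m) (h : L -> 'rV[R]_k).
Hypotheses (dL : differentiable_transitions L) (hh : immersion_on h setT).
Hypothesis cL : connected [set: L].
Variable N : L -> set 'rV[R]_k.
Hypothesis hN : normal_subbundle h N s.
Variable tau : {linear 'rV[R]_s -> (L -> 'rV[R]_k)}.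
Hypothesis tau_inj : injective tau.
Hypothesis tau_par : forall t, parallel_sections h N (tau t).

(** A section that is parallel for the normal connection has constant length: its
    derivative is tangent, hence orthogonal to it. *)
Lemma parallel_eq0 x t : tau t x = 0 -> t = 0.
Proof.
move=> tx0; apply: tau_inj; rewrite linear0; apply/funext => y; apply: dotv_eq0.
have [[st tN] pt] := tau_par t.
pose G u := dotv (tau t u) (tau t u).
have GE : G y = G x.
  apply: (dmap0_cst dL (F := G) openT cL) => // u; [move=> _|move=> v _].
    by apply: differentiable_dotv; exact: smooth_dmap.
  have dt := smooth_dmap u st.
  have nt : normal_space h u (tau t u) by apply: hN.1; exact: tN.
  have tt : dotv (dmap (tau t) u v) (tau t u) = 0.
    apply: etrans (esym (nproj_dot hh _ nt)) _.
    by rewrite -[Defs.nproj _ _ _]/(nabla_perp h (tau t) u v) pt dot0v.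
  have := derive_dotv v dt dt; rewrite /= param_center => E.
  by apply: (etrans E); rewrite (dotvC (tau t u)) [dotv _ _]tt addr0.
by rewrite -/(G y) GE /G tx0 dotv0.
Qed.

(** Evaluation at [x] is injective on a space of dimension [s], the rank of [N]. *)
Lemma parallel_onto x y : N x y -> exists t, y = tau t x.
Proof.
have [_ /(_ x)[U [e [_ Ux _ /(_ x Ux)[_ NE]]]]] := hN.
pose B : 'M[R]_(s, k) := \matrix_i e i x.
have NB z : N x z <-> exists w : 'rV[R]_s, z = w *m B.
  have sE w : w *m B = \sum_i w 0 i *: e i x.
    by rewrite mulmx_sum_row; apply: eq_bigr => i _; rewrite rowK.
  rewrite NE; split=> [[c _ <-]|[w ->]]; last by exists (w 0) => //; rewrite sE.
  exists (\row_i c i); rewrite sE; apply: eq_bigr => i _; by rewrite mxE.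
move=> /NB[w ->].
have fT := tau_mx_free parallel_eq0 x.
have TB t : exists w' : 'rV[R]_s, t *m tau_mx tau x = w' *m B.
  by rewrite -tauE; apply/NB; have [[_ tN] _] := tau_par t; exact: tN.
by have [t tE] := row_space_full fT TB w; exists t; rewrite tauE.
Qed.

End ParallelSections.

(** * The theorem *)

Theorem proposition7 (R : realType) (n s p : nat) (hs : (0 < s <= n)%N)
    (L : charted 'rV[R]_(n - s)) (hL : smooth_manifold L)
    (hsc : simply_connected R L)
    (h : L -> 'rV[R]_(n + p)) (hh : immersion_on h setT)
    (N : L -> set 'rV[R]_(n + p)) (hN : normal_subbundle h N s)
    (hpar : parallel_subbundle h N) (hflat : flat_subbundle h N)
    (w : set ((L -> R) * (L -> 'rV[R]_(n + p)))) (hw : Rib_classes h N w)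
    (phi : L -> R) (beta : L -> 'rV[R]_(n + p)) (hrep : w (phi, beta))
    (hE : forall x, Ew h N phi beta x = [set 0])
    (tau : {linear 'rV[R]_s -> (L -> 'rV[R]_(n + p))})
    (tau_inj : injective tau) (tau_range : range tau = parallel_sections h N) :
  let f := Rib_transform h tau phi beta in
  let M0 := Rib_regular h tau phi beta in
  let eta := Rib_eta h N tau phi beta in
  let leaf_of q := connected_component [set u : L | M0 (u, q.2)] q.1 in
  [/\ open M0 /\ immersion_on f M0,
      dupin_principal_normal f M0 eta s,
      integrable_distribution M0 (conullity f eta) (n - s),
      forall q, M0 q ->
        integral_manifold M0 (conullity f eta) (leaf_of q) (fun u => (u, q.2)) &
      forall S, leaf M0 (conullity f eta) (n - s) S <->
        exists2 q, M0 q & S = [set (u, q.2) | u in leaf_of q]].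
Proof.
move=> f M0 eta leaf_of.
have dL := smooth_manifold_transitions hL.
have pr : Rib_pairs h (phi, beta) by case: hw hrep => q _ -> [].
have tau_par t : parallel_sections h N (tau t) by rewrite -tau_range; exists t.
have tau_smooth t : smooth_on setT (tau t) by have [[]] := tau_par t.
have tauN t x : N x (tau t x) by have [[_ tN] _] := tau_par t; exact: tN.
have tau_parallel t x v : nabla_perp h (tau t) x v = 0 by have [_] := tau_par t; exact.
have cL := simply_connected_connected hsc.
have tau0 := parallel_eq0 dL hh cL hN tau_inj tau_par.
have tau_onto := parallel_onto dL hh cL hN tau_inj tau_par.
have [s0 _] := andP hs.
have integral u t : M0 (u, t) -> integral_manifold M0 (conullity f eta)
    (leaf_of (u, t)) (fun u' => (u', t)).
  exact: (leaf_integral dL hh pr hN.1 tau_smooth tau_parallel tauN tau0 tau_onto hE hL).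
split.
- split; first exact: (open_regular dL hh pr tau_smooth).
  exact: (immersion_transform dL hh pr tau_smooth).
- exact: (eta_dupin dL hh pr hN.1 tau_smooth tau_parallel tauN tau0 tau_onto hE s0).
- move=> [u t] r; exists L, (leaf_of (u, t)), (fun u' => (u', t)).
  split; first exact: integral.
  by exists u => //; exact: connected_component_refl.
- by move=> [u t] r; exact: integral.
- exact: (leaf_transformP dL hh pr hN.1 tau_smooth tau_parallel tauN tau0 tau_onto hE hL).
Qed.
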